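(* Let $\rho>0$, $A>0$, $R>0$, $J>0$, $C_f>0$ be constants, let $a'<0$ be a constant, let $\beta\in[\beta_{\min},\beta_{\max}]$ and $V_w>0$ be constants, and let $C_p:(0,\infty)\times[\beta_{\min},\beta_{\max}]\to\mathbb{R}$ satisfy: (A1) $C_p(\lambda,\beta)$ is continuously differentiable in both $\lambda$ and $\beta$ on $(0,\infty)\times[\beta_{\min},\beta_{\max}]$; (A2) there exists $c\in(0,\infty)$ with $C_p(\lambda,\beta)\le c\lambda$ for all $\lambda\in(0,\infty)$, $\beta\in[\beta_{\min},\beta_{\max}]$; (A3) for each fixed $\beta\in[\beta_{\min},\beta_{\max}]$ there exists $\lambda_1\in(0,\infty)$ with $C_p(\lambda,\beta)>0$ for all $\lambda\in(0,\lambda_1)$; (A4) there exist $\underline{c}\in(-\infty,0)$ and $\overline{c}\in(0,\infty)$ with $\underline{c}\le\frac{\partial}{\partial\lambda}\big(\frac{C_p(\lambda,\beta)}{\lambda}\big)\le\overline{c}$ for all $\lambda\in(0,\infty)$, $\beta\in[\beta_{\min},\beta_{\max}]$. Define, for $\omega_r>0$, $$g(\omega_r,\beta,V_w)=\frac{\tfrac12\rho A\, C_p\!\big(\tfrac{\omega_r R}{V_w},\beta\big)V_w^3}{\omega_r}-a'-C_f\omega_r .$$ Let $\omega_r^{(1)}\in(0,\infty)$ be such that $g(\omega_r^{(1)},\beta,V_w)=0$ and $g(\omega_r,\beta,V_w)>0$ for all $\omega_r\in(0,\omega_r^{(1)})$, and let $\underline{\gamma}\in(-\infty,0)$, $\overline{\gamma}\in(0,\infty)$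 be such that $\underline{\gamma}\le\frac{\partial}{\partial\omega_r}g(\omega_r,\beta,V_w)\le\overline{\gamma}$ for all $\omega_r\in(0,\infty)$. Consider the closed-loop system in the state $(\omega_r,\hat g)$: $$\dot\omega_r=\frac1J\Big(g(\omega_r,\beta,V_w)-\max\Big\{\hat g+\alpha\ln\frac{\omega_r}{\omega_{rd}},\,0\Big\}\Big),\qquad \dot{\hat g}=\frac hJ\big(g(\omega_r,\beta,V_w)-\hat g\big),$$ where $\omega_{rd}$ is a constant with $0<\omega_{rd}\le\omega_r^{(1)}$, and $\alpha,h\in\mathbb{R}$ are gains. Let $D=\{(\omega_r,\hat g):0<\omega_r\le\omega_r^{(1)},\ \hat g\in\mathbb{R}\}\subset\mathbb{R}^2$. If $\alpha>0$ and $$h>\overline{\gamma}\ \text{ if }\ \overline{\gamma}\ge-\tfrac13\underline{\gamma},\qquad h>-\frac{(\overline{\gamma}-\underline{\gamma})^2}{8(\underline{\gamma}+\overline{\gamma})}\ \text{ otherwise},$$ then: (i) the system has a unique equilibrium point in $D$, namely $(\omega_{rd},g(\omega_{rd},\beta,V_w))$; (ii) $D$ is positively invariant, i.e., if $(\omega_r(0),\hat g(0))\in D$ then $(\omega_r(t),\hat g(t))\in D$ for all $t\ge0$; and (iii) the equilibrium point $(\omega_{rd},g(\omega_{rd},\beta,V_w))$ is locally asymptotically stable with domain of attraction $D$.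
   Context: This models a wind turbine rotor: $\omega_r$ is the rotor angular velocity, $\omega_{rd}$ its desired value, $\hat g$ an estimate of the lumped uncertainty $g$, $J$ the moment of inertia, $C_f$ the friction coefficient, $\rho$ the air density, $A=\pi R^2$ the swept area of blades of radius $R$, $V_w$ the wind speed, $\beta$ the blade pitch angle, and $C_p(\lambda,\beta)$ the performance coefficient as a function of tip speed ratio $\lambda=\omega_r R/V_w$ and pitch. The constant $a'$ equals $-\frac{v_{ds}^2+v_{qs}^2}{4\omega_s R_s}$ for electrical parameters with $\omega_s,R_s>0$ and $(v_{ds},v_{qs})\neq(0,0)$, hence is negative. The paper asserts that under (A1)–(A4) a point $\omega_r^{(1)}$ and constants $\underline\gamma,\overline\gamma$ as described exist. *)

(* Defs.v *)
From Stdlib Require Import Reals Lra.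
From Coquelicot Require Import Coquelicot.
Open Scope R_scope.

Definition gfun (rho A Rad Cf a' : R) (Cp : R -> R -> R) (beta Vw : R) (w : R) : R :=
  (1/2 * rho * A * Cp (w * Rad / Vw) beta * Vw ^ 3) / w - a' - Cf * w.

Definition rhs_w (J alpha wrd : R) (g : R -> R) (w gh : R) : R :=
  (g w - Rmax (gh + alpha * ln (w / wrd)) 0) / J.

Definition rhs_g (J h : R) (g : R -> R) (w gh : R) : R :=
  h / J * (g w - gh).

(* (w, gh) is a solution on [0, +oo) of  w' = F1 w gh,  gh' = F2 w gh :
   w stays in the domain w > 0 of the vector field, both components are
   right-continuous at 0 and differentiable with the prescribed derivative
   at every t > 0. *)
Definition is_solution (F1 F2 : R -> R -> R) (w gh : R -> R) : Prop :=
  (forall t, 0 <= t -> 0 < w t) /\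
  filterlim w (at_right 0) (locally (w 0)) /\
  filterlim gh (at_right 0) (locally (gh 0)) /\
  (forall t, 0 < t ->
     is_derive w t (F1 (w t) (gh t)) /\ is_derive gh t (F2 (w t) (gh t))).

Definition inD (w1 w gh : R) : Prop := 0 < w <= w1.

(* Main.v *)
Require Import Defs.
From Stdlib Require Import Reals Lra Lia.
From Coquelicot Require Import Coquelicot.
Open Scope R_scope.

(* Put [e = gh - g w], [y = alpha ln (w / wrd)] and [u = J w'].  The Lyapunov function
   [V = e^2 / 2 + k alpha (w ln (w / wrd) - w + wrd)] satisfies
   [J V' = - h e^2 - g'(w) e u + k y u].  Without saturation [u = - (e + y)] and [- J V'] is a
   quadratic form in [(e, y)], positive definite iff [(k + g'(w))^2 < 4 k h]; the best choice of
   [k] over the slopes in [[gl, gu]] is [gu] or [- (gl + gu) / 2], and yields the two cases of the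
   gain condition.  Under saturation [u = g w] lies between [0] and [- (e + y)], and [J V'] is
   affine in [u], so it is still nonpositive.

   The sublevel sets of [V] are not compact near [w = 0], but a trajectory cannot approach
   [w = 0]: [gh] is bounded above, hence the controller is off for small [w], where
   [J w' = g w >= 0].  On the part of a trajectory with [V >= eta] the derivative [V'] is
   therefore bounded away from [0], and [V] tends to [0].  The same lower barrier lets one
   truncate the field in [w] to a globally Lipschitz one, for which Picard iteration gives a
   global solution. *)

(** * Differential inequalities *)

Lemma continuous_R_eps (f : R -> R) (x : R) :
  (forall eps, 0 < eps -> exists d, 0 < d /\
     forall y, Rabs (y - x) < d -> Rabs (f y - f x) < eps) ->
  continuous f x.
Proof.
  intros H. apply filterlim_locally. intros [e He].
  destruct (H e He) as [d [Hd Hf]]. exists (mkposreal d Hd). exact Hf.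
Qed.

Lemma continuous_R_inv (f : R -> R) (x eps : R) :
  continuous f x -> 0 < eps ->
  exists d, 0 < d /\ forall y, Rabs (y - x) < d -> Rabs (f y - f x) < eps.
Proof.
  intros H He. destruct (proj1 (filterlim_locally f (f x)) H (mkposreal eps He)) as [[d Hd] Hf].
  exists d. split; [exact Hd|exact Hf].
Qed.

Lemma locally_pos (t : R) : 0 < t -> locally t (fun s => 0 < s).
Proof.
  intros Ht. exists (mkposreal t Ht). intros s Hs.
  unfold ball in Hs; simpl in Hs; unfold AbsRing_ball, abs, minus, plus, opp in Hs; simpl in Hs.
  apply Rabs_def2 in Hs. lra.
Qed.

(** Nothing is known about a solution at negative times. Freezing it at its value at [0] there gives
    a function continuous on the whole line, to which the mean value theorem and supremum arguments
    apply. *)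
Lemma continuous_extend_left (f f' : R -> R) :
  filterlim f (at_right 0) (locally (f 0)) ->
  (forall t, 0 < t -> is_derive f t (f' t)) ->
  forall t, continuous (fun s => f (Rmax s 0)) t.
Proof.
  intros H0 Hd t. destruct (Rtotal_order t 0) as [Ht|[Ht|Ht]].
  - apply continuous_R_eps. intros eps He. exists (- t). split; [lra|].
    intros y Hy. apply Rabs_def2 in Hy. rewrite !Rmax_right by lra.
    rewrite Rminus_diag, Rabs_R0. exact He.
  - subst t. apply continuous_R_eps. intros eps He.
    destruct (proj1 (filterlim_locally f (f 0)) H0 (mkposreal eps He)) as [[d Hd'] Hf].
    exists d. split; [exact Hd'|]. intros y Hy. rewrite (Rmax_left 0 0) by lra.
    destruct (Rle_lt_dec y 0) as [Hy0|Hy0].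
    + rewrite Rmax_right by lra. rewrite Rminus_diag, Rabs_R0. exact He.
    + rewrite Rmax_left by lra. exact (Hf y Hy Hy0).
  - apply (continuous_ext_loc _ f).
    + generalize (locally_pos t Ht). apply filter_imp. intros s Hs.
      now rewrite Rmax_left by lra.
    + apply @ex_derive_continuous. exists (f' t). now apply Hd.
Qed.

Lemma is_derive_extend_left (f : R -> R) (t l : R) :
  0 < t -> is_derive f t l -> is_derive (fun s => f (Rmax s 0)) t l.
Proof.
  intros Ht. apply is_derive_ext_loc. generalize (locally_pos t Ht).
  apply filter_imp. intros s Hs. now rewrite Rmax_left by lra.
Qed.

Lemma nondecreasing_of_derive (f f' : R -> R) (a b : R) :
  a <= b -> (forall t, continuous f t) ->
  (forall t, a < t < b -> is_derive f t (f' t)) ->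
  (forall t, a < t < b -> 0 <= f' t) -> f a <= f b.
Proof.
  intros Hab Hc Hd Hp. destruct (Req_dec a b) as [->|Hne]; [lra|].
  (* MVT_gen only locates its point in the closed interval: put the junk value 0 at the endpoints. *)
  destruct (MVT_gen f a b
    (fun t => if Rlt_dec a t then if Rlt_dec t b then f' t else 0 else 0)) as [c [Hc1 Hc2]].
  - rewrite Rmin_left, Rmax_right by lra. intros x Hx.
    destruct (Rlt_dec a x); [|lra]. destruct (Rlt_dec x b); [|lra]. now apply Hd.
  - intros x _. apply continuity_pt_filterlim, Hc.
  - assert (0 <= (if Rlt_dec a c then if Rlt_dec c b then f' c else 0 else 0)).
    { destruct (Rlt_dec a c); [|lra]. destruct (Rlt_dec c b); [|lra]. apply Hp; lra. }
    assert (0 <= (if Rlt_dec a c then if Rlt_dec c b then f' c else 0 else 0) * (b - a)).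
    { apply Rmult_le_pos; lra. }
    lra.
Qed.

(** If [f t1 < m], let [s] be the last time up to [t1] with [m <= f s]. After [s] the function is
    below [m], hence nondecreasing, so [m <= f s <= f t1]. *)
Lemma barrier_below (f f' : R -> R) (m : R) :
  filterlim f (at_right 0) (locally (f 0)) ->
  (forall t, 0 < t -> is_derive f t (f' t)) ->
  m <= f 0 ->
  (forall t, 0 < t -> f t < m -> 0 <= f' t) ->
  forall t, 0 <= t -> m <= f t.
Proof.
  intros Hf0 Hd H0 Hb t1 Ht1. apply Rnot_lt_le. intros Hlt.
  pose proof (continuous_extend_left f f' Hf0 Hd) as Hc.
  set (F := fun s => f (Rmax s 0)) in Hc.
  assert (HF : forall s, 0 <= s -> F s = f s).
  { intros s Hs. unfold F. now rewrite Rmax_left by lra. }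
  destruct (completeness (fun s => 0 <= s <= t1 /\ m <= F s)) as [s [Hub Hleast]].
  { exists t1. intros s Hs. apply Hs. }
  { exists 0. split; [lra|]. now rewrite HF by lra. }
  assert (Hs0 : 0 <= s). { apply Hub. split; [lra|]. now rewrite HF by lra. }
  assert (Hs1 : s <= t1). { apply Hleast. intros x Hx. apply Hx. }
  assert (HFs : m <= F s).
  (* The supremum is attained: otherwise continuity keeps [F] below [m] near [s], and [s - d] would
     be a smaller upper bound. *)
  { apply Rnot_lt_le. intros Hs.
    destruct (continuous_R_inv F s (m - F s) (Hc s)) as [d [Hd0 Hdd]]; [lra|].
    assert (s <= s - d); [|lra]. apply Hleast. intros x [Hx1 Hx2].
    apply Rnot_lt_le. intros Hx.
    assert (x <= s) by (apply Hub; auto).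
    assert (Hxd : Rabs (x - s) < d) by (apply Rabs_def1; lra).
    apply Hdd, Rabs_def2 in Hxd. lra. }
  assert (F s <= F t1).
  { apply (nondecreasing_of_derive F f'); [exact Hs1|exact Hc| |].
    - intros t Ht. apply is_derive_extend_left; [lra|]. apply Hd; lra.
    - intros t Ht. apply Hb; [lra|]. rewrite <- HF by lra.
      apply Rnot_le_lt. intros Hm. assert (t <= s); [|lra].
      apply Hub. split; [lra|exact Hm]. }
  rewrite (HF t1) in H by lra. lra.
Qed.

Lemma barrier_above (f f' : R -> R) (m : R) :
  filterlim f (at_right 0) (locally (f 0)) ->
  (forall t, 0 < t -> is_derive f t (f' t)) ->
  f 0 <= m ->
  (forall t, 0 < t -> m < f t -> f' t <= 0) ->
  forall t, 0 <= t -> f t <= m.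
Proof.
  intros Hf0 Hd H0 Hb t Ht.
  enough (- m <= - f t) by lra.
  apply (barrier_below (fun s => - f s) (fun s => - f' s) (- m)); [| |lra| |exact Ht].
  - apply (filterlim_comp _ _ _ f Ropp _ (locally (f 0)) _ Hf0).
    apply @filterlim_opp.
  - intros s Hs. apply @is_derive_opp. now apply Hd.
  - intros s Hs Hm. enough (f' s <= 0) by lra. apply Hb; lra.
Qed.

Lemma lyapunov_decreasing (V V' : R -> R) :
  filterlim V (at_right 0) (locally (V 0)) ->
  (forall t, 0 < t -> is_derive V t (V' t)) ->
  (forall t, 0 < t -> V' t <= 0) ->
  forall s t, 0 <= s <= t -> V t <= V s.
Proof.
  intros H0 Hd Hn s t Hst.
  enough (- V (Rmax s 0) <= - V (Rmax t 0)) by (rewrite !Rmax_left in H; lra).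
  apply (nondecreasing_of_derive (fun u => - V (Rmax u 0)) (fun u => - V' u)); [lra| | |].
  - intros u. apply @continuous_opp. now apply (continuous_extend_left V V').
  - intros u Hu. apply @is_derive_opp.
    apply is_derive_extend_left; [lra|]. apply Hd; lra.
  - intros u Hu. enough (V' u <= 0) by lra. apply Hn; lra.
Qed.

(** If [V] is still at least [eta] after time [T], monotonicity puts it above [eta] on all of
    [[0, T]], where it falls at rate at least [c]; for large [T] it would become negative. *)
Lemma lyapunov_vanishes (V V' : R -> R) :
  filterlim V (at_right 0) (locally (V 0)) ->
  (forall t, 0 < t -> is_derive V t (V' t)) ->
  (forall t, 0 <= t -> 0 <= V t) ->
  (forall t, 0 < t -> V' t <= 0) ->
  (forall eta, 0 < eta -> exists c, 0 < c /\
     forall t, 0 < t -> eta <= V t -> V' t <= - c) ->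
  forall eta, 0 < eta -> exists T, 0 <= T /\ forall t, T <= t -> V t < eta.
Proof.
  intros H0 Hd Hp Hn Hc eta Heta.
  pose proof (lyapunov_decreasing V V' H0 Hd Hn) as Hmono.
  destruct (Hc eta Heta) as [c [Hc0 Hcc]].
  (* Chosen so that [c T = V 0 + c] exceeds the initial value. *)
  set (T := V 0 / c + 1).
  assert (HV0 : 0 <= V 0) by (apply Hp; lra).
  assert (HT : 0 < T).
  { unfold T. assert (0 <= V 0 / c) by (apply Rdiv_le_0_compat; lra). lra. }
  exists T. split; [lra|]. intros t Ht. apply Rnot_le_lt. intros Hle.
  assert (HVT : forall s, 0 <= s <= T -> eta <= V s).
  { intros s Hs. apply Rle_trans with (V t); [exact Hle|]. apply Hmono; lra. }
  assert (- (V (Rmax 0 0)) - c * 0 <= - V (Rmax T 0) - c * T).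
  { apply (nondecreasing_of_derive (fun u => - V (Rmax u 0) - c * u) (fun u => - V' u - c)); [lra| | |].
    - intros u. apply @continuous_minus.
      + apply @continuous_opp. now apply (continuous_extend_left V V').
      + apply @continuous_scal_r. apply continuous_id.
    - intros u Hu. apply @is_derive_minus.
      + apply @is_derive_opp. apply is_derive_extend_left; [lra|]. apply Hd; lra.
      + auto_derive; [easy|ring].
    - intros u Hu. enough (V' u <= - c) by lra. apply Hcc; [lra|]. apply HVT; lra. }
  rewrite !Rmax_left in H by lra.
  assert (c * T = V 0 + c) by (unfold T; field; lra).
  pose proof (Hp T). lra.
Qed.

(** * Picard iteration *)

Lemma exp_le (x y : R) : x <= y -> exp x <= exp y.
Proof. intros [H| ->]; [left; now apply exp_increasing|lra]. Qed.

Lemma is_RInt_exp (c K t : R) : K <> 0 ->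
  is_RInt (fun s => c * exp (K * s)) 0 t (c / K * exp (K * t) - c / K).
Proof.
  intros HK.
  replace (c / K * exp (K * t) - c / K)
    with (minus (c / K * exp (K * t)) (c / K * exp (K * 0))).
  - apply (is_RInt_derive (fun s => c / K * exp (K * s))).
    + intros s _. auto_derive; [easy|]. now field.
    + intros s _. apply @ex_derive_continuous. auto_derive. easy.
  - unfold minus, plus, opp; simpl. rewrite Rmult_0_r, exp_0. ring.
Qed.

(** Integration from [0] gains a factor [1 / K] against the weight [exp (K t)]. This is what makes
    the Picard map a contraction on all of [[0, +oo)] at once. *)
Lemma abs_RInt_le_exp (f : R -> R) (c K t : R) :
  0 <= c -> 0 < K -> 0 <= t -> ex_RInt f 0 t ->
  (forall s, 0 <= s <= t -> Rabs (f s) <= c * exp (K * s)) ->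
  Rabs (RInt f 0 t) <= c / K * exp (K * t).
Proof.
  intros Hc HK Ht Hex Hf.
  apply Rle_trans with (c / K * exp (K * t) - c / K).
  - apply (norm_RInt_le f (fun s => c * exp (K * s)) 0 t); [exact Ht|exact Hf| |].
    + now apply @RInt_correct.
    + apply is_RInt_exp. lra.
  - assert (0 <= c / K) by (apply Rdiv_le_0_compat; lra). lra.
Qed.

Definition lip2 (L : R) (F : R -> R -> R) : Prop :=
  forall x y x' y', Rabs (F x y - F x' y') <= L * (Rabs (x - x') + Rabs (y - y')).

Lemma lip2_continuous (L : R) (F : R -> R -> R) (x y : R -> R) (t : R) :
  0 < L -> lip2 L F -> continuous x t -> continuous y t ->
  continuous (fun s => F (x s) (y s)) t.
Proof.
  intros HL HF Hx Hy. apply continuous_R_eps. intros eps He.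
  assert (He' : 0 < eps / (2 * L)) by (apply Rdiv_lt_0_compat; lra).
  destruct (continuous_R_inv x t _ Hx He') as [d1 [Hd1 H1]].
  destruct (continuous_R_inv y t _ Hy He') as [d2 [Hd2 H2]].
  exists (Rmin d1 d2). split; [now apply Rmin_pos|]. intros s Hs.
  assert (Rabs (x s - x t) < eps / (2 * L)) by (apply H1; eapply Rlt_le_trans; [exact Hs|apply Rmin_l]).
  assert (Rabs (y s - y t) < eps / (2 * L)) by (apply H2; eapply Rlt_le_trans; [exact Hs|apply Rmin_r]).
  eapply Rle_lt_trans; [apply HF|].
  replace eps with (L * (eps / (2 * L) + eps / (2 * L))) by (field; lra).
  apply Rmult_lt_compat_l; lra.
Qed.

Lemma half_pow_pos (n : nat) : 0 < (1/2) ^ n.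
Proof. apply pow_lt; lra. Qed.

Lemma half_pow_small (C eps : R) :
  0 <= C -> 0 < eps -> exists n : nat, C * (1/2) ^ n < eps.
Proof.
  intros HC He.
  destruct (pow_lt_1_zero (1/2)) with (y := eps / (C + 1)) as [n Hn].
  - rewrite Rabs_pos_eq; lra.
  - apply Rdiv_lt_0_compat; lra.
  - exists n. specialize (Hn n (le_n n)).
    rewrite Rabs_pos_eq in Hn by (left; apply half_pow_pos).
    apply Rle_lt_trans with ((C + 1) * (1/2) ^ n).
    + pose proof (half_pow_pos n). nra.
    + apply Rmult_lt_reg_r with (/ (C + 1)); [apply Rinv_0_lt_compat; lra|].
      replace ((C + 1) * (1 / 2) ^ n * / (C + 1)) with ((1/2) ^ n) by (field; lra).
      exact Hn.
Qed.

Lemma Rabs_le_half_pow_0 (z C : R) :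
  0 <= C -> (forall n : nat, Rabs z <= C * (1/2) ^ n) -> z = 0.
Proof.
  intros HC H. destruct (Req_dec z 0) as [|Hz]; [easy|]. apply Rabs_pos_lt in Hz.
  destruct (half_pow_small C (Rabs z) HC Hz) as [n Hn]. specialize (H n). lra.
Qed.

Lemma geometric_limit (u : nat -> R) (C : R) :
  0 <= C -> (forall n, Rabs (u (S n) - u n) <= C * (1/2) ^ n) ->
  forall n, Rabs (u n - Lim_seq u) <= 2 * C * (1/2) ^ n.
Proof.
  intros HC Hu.
  (* The subtracted term is the exact remainder of the geometric sum; with it the induction on [p]
     closes. *)
  assert (Htail : forall n p, Rabs (u (n + p)%nat - u n) <= 2 * C * (1/2) ^ n - 2 * C * (1/2) ^ (n + p)).
  { intros n p. induction p as [|p IH].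
    - rewrite Nat.add_0_r, Rminus_diag, Rabs_R0. lra.
    - rewrite Nat.add_succ_r.
      replace (u (S (n + p)) - u n) with ((u (S (n + p)) - u (n + p)%nat) + (u (n + p)%nat - u n)) by ring.
      eapply Rle_trans; [apply Rabs_triang|]. specialize (Hu (n + p)%nat). simpl. lra. }
  assert (Hb : forall n m, (n <= m)%nat -> Rabs (u m - u n) <= 2 * C * (1/2) ^ n).
  { intros n m Hnm. replace m with (n + (m - n))%nat by lia.
    eapply Rle_trans; [apply Htail|].
    pose proof (half_pow_pos (n + (m - n))).
    assert (0 <= C * (1/2) ^ (n + (m - n))) by (apply Rmult_le_pos; lra). lra. }
  assert (Hex : ex_finite_lim_seq u).
  { apply ex_lim_seq_cauchy_corr. intros [eps He]. simpl.
    destruct (half_pow_small (4 * C) eps) as [N HN]; [lra|exact He|].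
    exists N. intros n m Hn Hm.
    replace (u n - u m) with ((u n - u N) - (u m - u N)) by ring.
    eapply Rle_lt_trans; [apply Rabs_triang|]. rewrite Rabs_Ropp.
    pose proof (Hb N n Hn). pose proof (Hb N m Hm). lra. }
  apply Lim_seq_correct' in Hex. intros n.
  assert (Hl : is_lim_seq (fun m => Rabs (u m - u n)) (Rabs (Lim_seq u - u n))).
  { apply (is_lim_seq_abs _ (Finite (Lim_seq u - u n))).
    apply is_lim_seq_minus'; [exact Hex|apply is_lim_seq_const]. }
  rewrite Rabs_minus_sym.
  refine (is_lim_seq_le_loc _ (fun _ => 2 * C * (1/2) ^ n) (Finite _) (Finite _) _ Hl (is_lim_seq_const _)).
  exists n. intros m Hm. now apply Hb.
Qed.

Fixpoint picard (F1 F2 : R -> R -> R) (a b : R) (n : nat) : (R -> R) * (R -> R) :=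
  match n with
  | O => (fun _ => a, fun _ => b)
  | S n => let p := picard F1 F2 a b n in
      (fun t => a + RInt (fun s => F1 (fst p s) (snd p s)) 0 t,
       fun t => b + RInt (fun s => F2 (fst p s) (snd p s)) 0 t)
  end.

Lemma is_derive_integral (f : R -> R) (a t : R) :
  (forall s, continuous f s) -> is_derive (fun u => a + RInt f 0 u) t (f t).
Proof.
  intros Hf. replace (f t) with (plus 0 (f t)) by (unfold plus; simpl; ring).
  apply @is_derive_plus; [apply @is_derive_const|].
  apply (is_derive_RInt f (fun u => RInt f 0 u) 0 t); [|apply Hf].
  apply filter_forall. intros u. apply @RInt_correct.
  apply @ex_RInt_continuous. intros z _. apply Hf.
Qed.

Lemma picard_continuous (F1 F2 : R -> R -> R) (L a b : R) :
  0 < L -> lip2 L F1 -> lip2 L F2 -> forall n t,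
  continuous (fst (picard F1 F2 a b n)) t /\ continuous (snd (picard F1 F2 a b n)) t.
Proof.
  intros HL H1 H2 n. induction n as [|n IH]; intros t; simpl.
  - split; apply continuous_const.
  - split; apply @ex_derive_continuous; eexists; apply is_derive_integral;
      intros s; apply (lip2_continuous L); auto; apply IH.
Qed.

(* With the weight exp (4 L t) one Picard step halves the distance. *)
Lemma integral_lip2_exp (F : R -> R -> R) (L M t : R) (x y x' y' : R -> R) :
  0 < L -> lip2 L F -> 0 <= M -> 0 <= t ->
  (forall s, continuous x s) -> (forall s, continuous y s) ->
  (forall s, continuous x' s) -> (forall s, continuous y' s) ->
  (forall s, 0 <= s <= t -> Rabs (x s - x' s) <= M * exp (4 * L * s)) ->
  (forall s, 0 <= s <= t -> Rabs (y s - y' s) <= M * exp (4 * L * s)) ->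
  Rabs (RInt (fun s => F (x s) (y s)) 0 t - RInt (fun s => F (x' s) (y' s)) 0 t)
    <= M / 2 * exp (4 * L * t).
Proof.
  intros HL HF HM Ht Hx Hy Hx' Hy' Hdx Hdy.
  assert (E : forall u v : R -> R, (forall s, continuous u s) -> (forall s, continuous v s) ->
    ex_RInt (fun s => F (u s) (v s)) 0 t).
  { intros u v Hu Hv. apply @ex_RInt_continuous. intros z _. now apply (lip2_continuous L). }
  assert (Eq := RInt_minus _ _ 0 t (E x y Hx Hy) (E x' y' Hx' Hy')).
  unfold minus, plus, opp in Eq; simpl in Eq.
  replace (RInt (fun s => F (x s) (y s)) 0 t - RInt (fun s => F (x' s) (y' s)) 0 t)
    with (RInt (fun s => F (x s) (y s) + - F (x' s) (y' s)) 0 t) by exact Eq.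
  replace (M / 2) with (2 * L * M / (4 * L)) by (field; lra).
  apply abs_RInt_le_exp; [|lra|exact Ht| |].
  - apply Rmult_le_pos; lra.
  - apply (ex_RInt_minus _ _ 0 t (E x y Hx Hy) (E x' y' Hx' Hy')).
  - intros s Hs. eapply Rle_trans; [apply HF|].
    pose proof (Hdx s Hs). pose proof (Hdy s Hs).
    replace (2 * L * M * exp (4 * L * s)) with (L * (M * exp (4 * L * s) + M * exp (4 * L * s))) by ring.
    apply Rmult_le_compat_l; lra.
Qed.

Lemma picard_step (F1 F2 : R -> R -> R) (L a b : R) :
  0 < L -> lip2 L F1 -> lip2 L F2 ->
  exists M, 0 <= M /\ forall n t, 0 <= t ->
    Rabs (fst (picard F1 F2 a b (S n)) t - fst (picard F1 F2 a b n) t)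
      <= M * (1/2) ^ n * exp (4 * L * t) /\
    Rabs (snd (picard F1 F2 a b (S n)) t - snd (picard F1 F2 a b n) t)
      <= M * (1/2) ^ n * exp (4 * L * t).
Proof.
  intros HL H1 H2.
  (* The first iteration integrates the constant fields [F1 a b] and [F2 a b], and the weighted
     bound divides by [4 L]. *)
  set (M := (Rabs (F1 a b) + Rabs (F2 a b)) / (4 * L)).
  pose proof (Rabs_pos (F1 a b)). pose proof (Rabs_pos (F2 a b)).
  assert (HM : 0 <= M) by (apply Rdiv_le_0_compat; lra).
  exists M. split; [exact HM|]. intros n. induction n as [|n IH]; intros t Ht.
  - assert (B : forall c z, Rabs z <= Rabs (F1 a b) + Rabs (F2 a b) ->
      Rabs (c + RInt (fun _ => z) 0 t - c) <= M * (1/2) ^ 0 * exp (4 * L * t)).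
    { intros c z Hz. rewrite Rplus_minus_l.
      simpl. rewrite Rmult_1_r. apply abs_RInt_le_exp; [lra|lra|exact Ht| |].
      - apply ex_RInt_const.
      - intros s Hs. assert (1 <= exp (4 * L * s)).
        { rewrite <- exp_0. apply exp_le. apply Rmult_le_pos; lra. }
        nra. }
    split; [apply (B a (F1 a b))|apply (B b (F2 a b))]; lra.
  - assert (C := picard_continuous F1 F2 L a b HL H1 H2).
    assert (HMn : 0 <= M * (1/2) ^ n).
    { apply Rmult_le_pos; [exact HM|left; apply half_pow_pos]. }
    replace (M * (1/2) ^ S n) with (M * (1/2) ^ n / 2) by (simpl; field).
    assert (B : forall c z z' r, Rabs (z - z') <= r -> Rabs (c + z - (c + z')) <= r).
    { intros c z z' r. now replace (c + z - (c + z')) with (z - z') by ring. }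
    set (P := picard F1 F2 a b) in *.
    assert (D : forall F, lip2 L F ->
      Rabs (RInt (fun s => F (fst (P (S n)) s) (snd (P (S n)) s)) 0 t
            - RInt (fun s => F (fst (P n) s) (snd (P n) s)) 0 t)
        <= M * (1/2) ^ n / 2 * exp (4 * L * t)).
    { intros F HF. apply integral_lip2_exp; auto; intros s; try apply C; intros Hs; apply IH; lra. }
    split; [exact (B a _ _ _ (D F1 H1))|exact (B b _ _ _ (D F2 H2))].
Qed.

(** A three-epsilon argument. Since [E] is monotone, the approximation is uniform on [(-oo, t + 1]],
    so one index [n] serves a whole neighbourhood of [t]. *)
Lemma continuous_of_approx (u : nat -> R -> R) (x E : R -> R) :
  (forall n t, continuous (u n) t) ->
  (forall s t, s <= t -> 0 <= E s <= E t) ->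
  (forall n t, Rabs (u n t - x t) <= E t * (1/2) ^ n) ->
  forall t, continuous x t.
Proof.
  intros Hc HE Hu t. apply continuous_R_eps. intros eps He.
  destruct (half_pow_small (E (t + 1)) (eps / 3)) as [n Hn].
  { apply (HE (t + 1) (t + 1)); lra. }
  { lra. }
  destruct (continuous_R_inv (u n) t (eps / 3) (Hc n t)) as [d [Hd Hdd]]; [lra|].
  exists (Rmin d 1). split; [apply Rmin_pos; lra|]. intros s Hs.
  assert (Hs1 : Rabs (s - t) < 1) by (eapply Rlt_le_trans; [exact Hs|apply Rmin_r]).
  assert (Hs2 : Rabs (s - t) < d) by (eapply Rlt_le_trans; [exact Hs|apply Rmin_l]).
  apply Rabs_def2 in Hs1. apply Hdd in Hs2.
  assert (B : forall r, r <= t + 1 -> Rabs (u n r - x r) < eps / 3).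
  { intros r Hr. eapply Rle_lt_trans; [apply Hu|]. eapply Rle_lt_trans; [|exact Hn].
    apply Rmult_le_compat_r; [left; apply half_pow_pos|]. now apply HE. }
  replace (x s - x t) with (- (u n s - x s) + ((u n s - u n t) + (u n t - x t))) by ring.
  eapply Rle_lt_trans; [apply Rabs_triang|]. rewrite Rabs_Ropp.
  pose proof (Rabs_triang (u n s - u n t) (u n t - x t)).
  assert (Rabs (u n s - x s) < eps / 3) by (apply B; lra).
  assert (Rabs (u n t - x t) < eps / 3) by (apply B; lra). lra.
Qed.

(** The iterates converge geometrically, locally uniformly in time, so the limit is continuous and
    the integral equation passes to the limit. Differentiating that equation gives the system. *)
Theorem picard_lindelof (F1 F2 : R -> R -> R) (L a b : R) :
  0 < L -> lip2 L F1 -> lip2 L F2 ->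
  exists x y : R -> R, x 0 = a /\ y 0 = b /\
    (forall t, continuous x t) /\ (forall t, continuous y t) /\
    forall t, 0 < t -> is_derive x t (F1 (x t) (y t)) /\ is_derive y t (F2 (x t) (y t)).
Proof.
  intros HL H1 H2.
  destruct (picard_step F1 F2 L a b HL H1 H2) as [M [HM HS]].
  assert (C := picard_continuous F1 F2 L a b HL H1 H2).
  set (P := picard F1 F2 a b) in *.
  (* The iteration estimates hold for nonnegative times; the limits are extended to the left by
     constants. *)
  set (x := fun t => real (Lim_seq (fun n => fst (P n) (Rmax t 0)))).
  set (y := fun t => real (Lim_seq (fun n => snd (P n) (Rmax t 0)))).
  set (E := fun t => 2 * (M * exp (4 * L * Rmax t 0))).
  assert (HE : forall s t, s <= t -> 0 <= E s <= E t).
  { intros s t Hst. unfold E. pose proof (exp_pos (4 * L * Rmax s 0)).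
    assert (exp (4 * L * Rmax s 0) <= exp (4 * L * Rmax t 0)).
    { apply exp_le. apply Rmult_le_compat_l; [lra|]. now apply Rle_max_compat_r. }
    split; [apply Rmult_le_pos; [lra|]; apply Rmult_le_pos; lra|].
    apply Rmult_le_compat_l; [lra|]. now apply Rmult_le_compat_l. }
  assert (Hx : forall n t, Rabs (fst (P n) (Rmax t 0) - x t) <= E t * (1/2) ^ n).
  { intros n t. apply (geometric_limit (fun n => fst (P n) (Rmax t 0))).
    - apply Rmult_le_pos; [exact HM|]. left. apply exp_pos.
    - intros m. eapply Rle_trans; [apply HS, Rmax_r|]. right; ring. }
  assert (Hy : forall n t, Rabs (snd (P n) (Rmax t 0) - y t) <= E t * (1/2) ^ n).
  { intros n t. apply (geometric_limit (fun n => snd (P n) (Rmax t 0))).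
    - apply Rmult_le_pos; [exact HM|]. left. apply exp_pos.
    - intros m. eapply Rle_trans; [apply HS, Rmax_r|]. right; ring. }
  assert (Cm : forall (f : R -> R) t, (forall s, continuous f s) -> continuous (fun s => f (Rmax s 0)) t).
  { intros f t Hf. apply (continuous_comp (fun s => Rmax s 0) f); [|apply Hf].
    apply continuous_R_eps. intros eps He. exists eps. split; [exact He|].
    intros s Hs. eapply Rle_lt_trans; [|exact Hs].
    unfold Rmax. repeat destruct Rle_dec; unfold Rabs; repeat destruct Rcase_abs; lra. }
  assert (Cx : forall t, continuous x t).
  { apply (continuous_of_approx (fun n t => fst (P n) (Rmax t 0)) x E); auto.
    intros n t. apply Cm. apply C. }
  assert (Cy : forall t, continuous y t).
  { apply (continuous_of_approx (fun n t => snd (P n) (Rmax t 0)) y E); auto.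
    intros n t. apply Cm. apply C. }
  (* Uniqueness of limits: the integrals along the iterates approach both [z - c] and the integral
     along the limit at a geometric rate. *)
  assert (I : forall F (c z t : R), 0 <= t -> lip2 L F ->
    (forall n, Rabs (c + RInt (fun s => F (fst (P n) s) (snd (P n) s)) 0 t - z) <= E t * (1/2) ^ n) ->
    z = c + RInt (fun s => F (x s) (y s)) 0 t).
  { intros F c z t Ht HF Hz. apply Rminus_diag_uniq.
    apply (Rabs_le_half_pow_0 _ (2 * E t)).
    { pose proof (HE t t). lra. }
    intros n. specialize (Hz n).
    set (I1 := RInt (fun s => F (fst (P n) s) (snd (P n) s)) 0 t) in *.
    set (I2 := RInt (fun s => F (x s) (y s)) 0 t).
    assert (Rabs (I1 - I2) <= 2 * M * (1/2) ^ n / 2 * exp (4 * L * t)).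
    { pose proof (half_pow_pos n).
      apply integral_lip2_exp; auto; try (intros s; apply C).
      - apply Rmult_le_pos; lra.
      - intros s Hs. pose proof (Hx n s) as B. unfold E in B. rewrite Rmax_left in B by lra.
        eapply Rle_trans; [exact B|]. right; ring.
      - intros s Hs. pose proof (Hy n s) as B. unfold E in B. rewrite Rmax_left in B by lra.
        eapply Rle_trans; [exact B|]. right; ring. }
    replace (z - (c + I2)) with (- (c + I1 - z) + (I1 - I2)) by ring.
    eapply Rle_trans; [apply Rabs_triang|]. rewrite Rabs_Ropp.
    assert (EE : E t * (1/2) ^ n = 2 * (2 * M * (1/2) ^ n / 2 * exp (4 * L * t))).
    { unfold E. rewrite Rmax_left by lra. field. }
    assert (0 <= E t * (1/2) ^ n).
    { pose proof (HE t t). pose proof (half_pow_pos n). apply Rmult_le_pos; lra. }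
    lra. }
  assert (Ix : forall t, 0 <= t -> x t = a + RInt (fun s => F1 (x s) (y s)) 0 t).
  { intros t Ht. apply (I F1); auto. intros n.
    change (a + RInt (fun s => F1 (fst (P n) s) (snd (P n) s)) 0 t) with (fst (P (S n)) t).
    pose proof (Hx (S n) t) as B. rewrite Rmax_left in B by lra.
    eapply Rle_trans; [exact B|]. pose proof (HE t t). pose proof (half_pow_pos n).
    simpl. nra. }
  assert (Iy : forall t, 0 <= t -> y t = b + RInt (fun s => F2 (x s) (y s)) 0 t).
  { intros t Ht. apply (I F2); auto. intros n.
    change (b + RInt (fun s => F2 (fst (P n) s) (snd (P n) s)) 0 t) with (snd (P (S n)) t).
    pose proof (Hy (S n) t) as B. rewrite Rmax_left in B by lra.
    eapply Rle_trans; [exact B|]. pose proof (HE t t). pose proof (half_pow_pos n).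
    simpl. nra. }
  exists x, y. split; [|split; [|split; [exact Cx|split; [exact Cy|]]]].
  - rewrite Ix by lra. rewrite RInt_point. apply Rplus_0_r.
  - rewrite Iy by lra. rewrite RInt_point. apply Rplus_0_r.
  - intros t Ht. split.
    + apply (is_derive_ext_loc (fun u => a + RInt (fun s => F1 (x s) (y s)) 0 u)).
      * generalize (locally_pos t Ht). apply filter_imp. intros s Hs. symmetry. apply Ix; lra.
      * apply (is_derive_integral (fun s => F1 (x s) (y s))). intros s. now apply (lip2_continuous L).
    + apply (is_derive_ext_loc (fun u => b + RInt (fun s => F2 (x s) (y s)) 0 u)).
      * generalize (locally_pos t Ht). apply filter_imp. intros s Hs. symmetry. apply Iy; lra.
      * apply (is_derive_integral (fun s => F2 (x s) (y s))). intros s. now apply (lip2_continuous L).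
Qed.

(** * Dissipation estimates *)

Lemma ln_le_sub1 (x : R) : 0 < x -> ln x <= x - 1.
Proof.
  intros Hx. pose proof (exp_ineq1_le (ln x)) as H. rewrite exp_ln in H by exact Hx. lra.
Qed.

Lemma ln_div_upper (w v : R) : 0 < w -> 0 < v -> ln (w / v) <= (w - v) / v.
Proof.
  intros Hw Hv. replace ((w - v) / v) with (w / v - 1) by (field; lra).
  apply ln_le_sub1. now apply Rdiv_lt_0_compat.
Qed.

Lemma ln_div_lower (w v : R) : 0 < w -> 0 < v -> (w - v) / w <= ln (w / v).
Proof.
  intros Hw Hv. pose proof (ln_div_upper v w Hv Hw) as H.
  rewrite ln_div in H by lra. rewrite ln_div by lra.
  replace ((w - v) / w) with (- ((v - w) / w)) by (field; lra). lra.
Qed.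

(** With [k = gu] the condition at [gu] reads [gu < h], and [gl >= - 3 gu] makes the one at [gl] no
    stronger. With [k = - (gl + gu) / 2] both squares equal [(gu - gl)^2 / 4], and the two
    conditions coincide with the assumed bound on [h]. *)
Lemma gain_condition_weight (gl gu h : R) :
  gl < 0 -> 0 < gu ->
  (if Rle_dec (- (1/3) * gl) gu then h > gu
   else h > - (gu - gl) ^ 2 / (8 * (gl + gu))) ->
  exists k, 0 < k /\ (k + gl) ^ 2 < 4 * k * h /\ (k + gu) ^ 2 < 4 * k * h.
Proof.
  intros Hl Hu Hh. destruct Rle_dec as [Hle|Hlt].
  - exists gu. split; [exact Hu|]. split; nra.
  - exists (- (gl + gu) / 2).
    assert (Hk : 0 < - (gl + gu)) by lra.
    assert (Hq : (gu - gl) ^ 2 < 8 * - (gl + gu) * h).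
    { replace ((gu - gl) ^ 2)
        with (8 * - (gl + gu) * (- (gu - gl) ^ 2 / (8 * (gl + gu)))) by (field; lra).
      apply Rmult_lt_compat_l; lra. }
    split; [lra|]. split; nra.
Qed.

(** The form has discriminant [(k + gam)^2 - 4 k h], convex in [gam], so negativity at [gl] and [gu]
    gives negativity between them. The point is a margin [q] independent of the slope. *)
Lemma dissipation_form_pos (gl gu h k : R) :
  gl < 0 -> 0 < gu -> 0 < k ->
  (k + gl) ^ 2 < 4 * k * h -> (k + gu) ^ 2 < 4 * k * h ->
  exists q, 0 < q /\ q <= h /\ forall gam e y, gl <= gam <= gu ->
    q * (e ^ 2 + y ^ 2) <= (h - gam) * e ^ 2 + (k - gam) * e * y + k * y ^ 2.
Proof.
  intros Hl Hu Hk H1 H2.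
  set (d := Rmin (4 * k * h - (k + gl) ^ 2) (4 * k * h - (k + gu) ^ 2) / (4 * k)).
  assert (Hd : 0 < d).
  { apply Rdiv_lt_0_compat; [|lra]. apply Rmin_pos; lra. }
  assert (Hdg : forall gam, gl <= gam <= gu -> (k + gam) ^ 2 <= 4 * k * (h - d)).
  { intros gam Hg. replace (4 * k * (h - d)) with (4 * k * h - 4 * k * d) by ring.
    replace (4 * k * d) with (Rmin (4 * k * h - (k + gl) ^ 2) (4 * k * h - (k + gu) ^ 2))
      by (unfold d; field; lra).
    pose proof (Rmin_l (4 * k * h - (k + gl) ^ 2) (4 * k * h - (k + gu) ^ 2)).
    pose proof (Rmin_r (4 * k * h - (k + gl) ^ 2) (4 * k * h - (k + gu) ^ 2)).
    destruct (Rle_dec 0 (k + gam)); nra. }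
  assert (Hh : 0 < h).
  { pose proof (pow2_ge_0 (k + gl)). apply Rmult_lt_reg_l with (4 * k); lra. }
  (* A bound, uniform in the slope, for the coefficient [r] of the completed square below. *)
  set (s := (k + gu - gl) / (2 * k)).
  assert (Hs : 0 <= s) by (apply Rdiv_le_0_compat; lra).
  (* The bound [h] serves the saturated regime. The other two make [2 q <= k] and
     [q (1 + 2 s^2) <= d], the coefficients left after [y^2] is estimated by
     [2 (y + r e)^2 + 2 s^2 e^2]. *)
  set (q := Rmin h (Rmin (k / 2) (d / (1 + 2 * s ^ 2)))).
  assert (Hs2 : 0 < 1 + 2 * s ^ 2) by (pose proof (pow2_ge_0 s); lra).
  assert (Hq : 0 < q).
  { repeat apply Rmin_pos; try lra. apply Rdiv_lt_0_compat; lra. }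
  assert (Hqk : q <= k / 2).
  { eapply Rle_trans; [apply Rmin_r|apply Rmin_l]. }
  assert (Hqd : q * (1 + 2 * s ^ 2) <= d).
  { replace d with (d / (1 + 2 * s ^ 2) * (1 + 2 * s ^ 2)) by (field; lra).
    apply Rmult_le_compat_r; [lra|]. eapply Rle_trans; apply Rmin_r. }
  exists q. split; [exact Hq|]. split; [apply Rmin_l|].
  intros gam e y Hg.
  set (r := (k - gam) / (2 * k)).
  assert (Hr : r ^ 2 <= s ^ 2).
  { assert (- s <= r <= s); [|nra]. unfold r, s. split.
    - replace (- ((k + gu - gl) / (2 * k))) with ((- (k + gu - gl)) / (2 * k)) by (field; lra).
      apply Rmult_le_compat_r; [left; apply Rinv_0_lt_compat; lra|lra].
    - apply Rmult_le_compat_r; [left; apply Rinv_0_lt_compat; lra|lra]. }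
  (* Completing the square: the form dominates [d e^2 + k (y + r e)^2]. *)
  assert (HQ : d * e ^ 2 + k * (y + r * e) ^ 2
    <= (h - gam) * e ^ 2 + (k - gam) * e * y + k * y ^ 2).
  { replace ((h - gam) * e ^ 2 + (k - gam) * e * y + k * y ^ 2)
      with (k * (y + r * e) ^ 2 + (4 * k * h - (k + gam) ^ 2) / (4 * k) * e ^ 2)
      by (unfold r; field; lra).
    assert (d <= (4 * k * h - (k + gam) ^ 2) / (4 * k)).
    { replace d with (4 * k * d / (4 * k)) by (field; lra).
      apply Rmult_le_compat_r; [left; apply Rinv_0_lt_compat; lra|].
      specialize (Hdg gam Hg). lra. }
    pose proof (pow2_ge_0 e).
    apply Rle_trans with (k * (y + r * e) ^ 2 + d * e ^ 2); [lra|].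
    apply Rplus_le_compat_l. now apply Rmult_le_compat_r. }
  eapply Rle_trans; [|exact HQ].
  assert (Hy : y ^ 2 <= 2 * (y + r * e) ^ 2 + 2 * s ^ 2 * e ^ 2).
  (* The identity behind this is [2 (y + r e)^2 + 2 r^2 e^2 - y^2 = (y + 2 r e)^2]. *)
  { pose proof (pow2_ge_0 (y + 2 * r * e)). pose proof (pow2_ge_0 e).
    assert (r ^ 2 * e ^ 2 <= s ^ 2 * e ^ 2) by (apply Rmult_le_compat_r; lra). lra. }
  pose proof (pow2_ge_0 e). pose proof (pow2_ge_0 (y + r * e)).
  assert (q * y ^ 2 <= q * (2 * (y + r * e) ^ 2 + 2 * s ^ 2 * e ^ 2))
    by (apply Rmult_le_compat_l; lra).
  assert (q * (1 + 2 * s ^ 2) * e ^ 2 <= d * e ^ 2) by (apply Rmult_le_compat_r; lra).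
  assert (q * (y + r * e) ^ 2 <= k / 2 * (y + r * e) ^ 2) by (apply Rmult_le_compat_r; lra).
  lra.
Qed.

(* [J] times the derivative of the Lyapunov function, where [gam] is the slope of [g],
   [G] its value, [e] the estimation error and [y = alpha ln (w / wrd)]. *)
Definition dissipation (h k gam G e y : R) : R :=
  let u := G - Rmax (G + e + y) 0 in - h * e ^ 2 - gam * e * u + k * y * u.

Lemma dissipation_unsaturated (h k gam q G e y : R) :
  q * (e ^ 2 + y ^ 2) <= (h - gam) * e ^ 2 + (k - gam) * e * y + k * y ^ 2 ->
  0 <= G + e + y -> dissipation h k gam G e y <= - q * (e ^ 2 + y ^ 2).
Proof.
  intros HQ Hs. unfold dissipation. rewrite Rmax_left by exact Hs. simpl in *. lra.
Qed.

(* [u = G] lies in [[0, S]] with [S = - (e + y)] and the dissipation is affine in [u]: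
   it interpolates between [- h e^2] and the value of the unsaturated form. *)
Lemma dissipation_saturated (h k gam q G e y : R) :
  q <= h -> 0 <= G ->
  q * (e ^ 2 + y ^ 2) <= (h - gam) * e ^ 2 + (k - gam) * e * y + k * y ^ 2 ->
  G + e + y < 0 ->
  dissipation h k gam G e y * - (e + y) <= - q * (e ^ 2 * - (e + y) + G * y ^ 2).
Proof.
  intros Hq HG HQ Hs. unfold dissipation. rewrite Rmax_right by lra.
  cbv zeta. rewrite Rminus_0_r.
  assert (A1 : G * (q * (e ^ 2 + y ^ 2)) <= G * ((h - gam) * e ^ 2 + (k - gam) * e * y + k * y ^ 2))
    by (apply Rmult_le_compat_l; lra).
  assert (A2 : q * (e ^ 2 * (- (e + y) - G)) <= h * (e ^ 2 * (- (e + y) - G))).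
  { apply Rmult_le_compat_r; [|exact Hq]. apply Rmult_le_pos; [apply pow2_ge_0|lra]. }
  lra.
Qed.

(** A bound common to both regimes, which gives the monotonicity of the Lyapunov function. Under
    saturation the positive factor [- (e + y)] is cancelled. *)
Lemma dissipation_le_error (h k gam q G e y : R) :
  0 < q -> q <= h -> 0 <= G ->
  q * (e ^ 2 + y ^ 2) <= (h - gam) * e ^ 2 + (k - gam) * e * y + k * y ^ 2 ->
  dissipation h k gam G e y <= - q * e ^ 2.
Proof.
  intros Hq0 Hq HG HQ. pose proof (pow2_ge_0 y).
  destruct (Rle_lt_dec 0 (G + e + y)) as [Hs|Hs].
  - pose proof (dissipation_unsaturated h k gam q G e y HQ Hs).
    assert (0 <= q * y ^ 2) by (apply Rmult_le_pos; lra). lra.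
  - pose proof (dissipation_saturated h k gam q G e y Hq HG HQ Hs) as HS.
    apply Rmult_le_reg_r with (- (e + y)); [lra|].
    eapply Rle_trans; [exact HS|].
    assert (0 <= q * (G * y ^ 2)) by (apply Rmult_le_pos; [lra|]; apply Rmult_le_pos; lra). lra.
Qed.

(** The delicate case is saturation with a small error [e]. Then [|y| >= eps] forces [y <= - eps],
    hence [G >= g0], and the saturated estimate is divided by [- (e + y) <= eps + |Y|]. *)
Lemma dissipation_uniform (h k q eps g0 Y : R) :
  0 < q -> q <= h -> 0 < eps -> 0 < g0 ->
  exists c, 0 < c /\ forall gam G e y, 0 <= G ->
    q * (e ^ 2 + y ^ 2) <= (h - gam) * e ^ 2 + (k - gam) * e * y + k * y ^ 2 ->
    (y <= - eps -> g0 <= G) -> - Y <= y -> eps <= Rabs e \/ eps <= Rabs y ->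
    dissipation h k gam G e y <= - c.
Proof.
  intros Hq0 Hq He Hg0.
  assert (HS : 0 < eps + Rabs Y) by (pose proof (Rabs_pos Y); lra).
  set (c := Rmin (q * eps ^ 2) (q * (g0 * eps ^ 2) / (eps + Rabs Y))).
  assert (Hee : 0 < eps ^ 2) by (apply pow_lt; lra).
  assert (Hc : 0 < c).
  { apply Rmin_pos; [now apply Rmult_lt_0_compat|].
    apply Rdiv_lt_0_compat; [|exact HS]. apply Rmult_lt_0_compat; [lra|now apply Rmult_lt_0_compat]. }
  exists c. split; [exact Hc|]. intros gam G e y HG HQ Hgy HY Hor.
  assert (Hc1 : c <= q * eps ^ 2) by apply Rmin_l.
  assert (Hc2 : c <= q * (g0 * eps ^ 2) / (eps + Rabs Y)) by apply Rmin_r.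
  assert (Hsq : forall z, eps <= Rabs z -> q * eps ^ 2 <= q * z ^ 2).
  { intros z Hz. apply Rmult_le_compat_l; [lra|].
    rewrite <- (pow2_abs z). apply pow_incr. lra. }
  pose proof (dissipation_le_error h k gam q G e y Hq0 Hq HG HQ) as Herr.
  destruct (Rle_lt_dec eps (Rabs e)) as [Hbe|Hbe].
  { specialize (Hsq e Hbe). lra. }
  assert (Hby : eps <= Rabs y) by (destruct Hor; lra).
  pose proof (Hsq y Hby) as Hy2. pose proof (pow2_ge_0 e) as He2.
  assert (Hqe : 0 <= q * e ^ 2) by (apply Rmult_le_pos; lra).
  destruct (Rle_lt_dec 0 (G + e + y)) as [Hs|Hs].
  { pose proof (dissipation_unsaturated h k gam q G e y HQ Hs). lra. }
  apply Rabs_def2 in Hbe.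
  assert (Hyn : y <= - eps).
  { unfold Rabs in Hby; destruct Rcase_abs; lra. }
  specialize (Hgy Hyn).
  pose proof (dissipation_saturated h k gam q G e y Hq HG HQ Hs) as H.
  assert (HSY : - (e + y) <= eps + Rabs Y) by (pose proof (Rle_abs Y); lra).
  apply Rmult_le_reg_r with (- (e + y)); [lra|].
  eapply Rle_trans; [exact H|].
  assert (A1 : c * - (e + y) <= c * (eps + Rabs Y)) by (apply Rmult_le_compat_l; lra).
  assert (A2 : c * (eps + Rabs Y) <= q * (g0 * eps ^ 2)).
  { replace (q * (g0 * eps ^ 2)) with (q * (g0 * eps ^ 2) / (eps + Rabs Y) * (eps + Rabs Y)) by (field; lra).
    apply Rmult_le_compat_r; lra. }
  assert (A3 : g0 * (q * eps ^ 2) <= G * (q * y ^ 2)).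
  { apply Rmult_le_compat; [lra| |lra|lra]. apply Rmult_le_pos; lra. }
  assert (A4 : 0 <= q * e ^ 2 * - (e + y)) by (apply Rmult_le_pos; lra).
  lra.
Qed.

(** * Invariance and existence of solutions *)

Lemma at_right_comp (phi f : R -> R) :
  filterlim f (at_right 0) (locally (f 0)) -> continuous phi (f 0) ->
  filterlim (fun t => phi (f t)) (at_right 0) (locally (phi (f 0))).
Proof. intros Hf Hphi. exact (filterlim_comp _ _ _ f phi _ _ _ Hf Hphi). Qed.

Lemma at_right_plus (f g : R -> R) :
  filterlim f (at_right 0) (locally (f 0)) -> filterlim g (at_right 0) (locally (g 0)) ->
  filterlim (fun t => f t + g t) (at_right 0) (locally (f 0 + g 0)).
Proof.
  intros Hf Hg. apply (filterlim_comp_2 _ _ Rplus Hf Hg).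
  exact (filterlim_plus (f 0) (g 0)).
Qed.

Lemma at_right_mult (f g : R -> R) :
  filterlim f (at_right 0) (locally (f 0)) -> filterlim g (at_right 0) (locally (g 0)) ->
  filterlim (fun t => f t * g t) (at_right 0) (locally (f 0 * g 0)).
Proof.
  intros Hf Hg. apply (filterlim_comp_2 _ _ Rmult Hf Hg).
  exact (filterlim_mult (f 0) (g 0)).
Qed.

Lemma at_right_continuous (f : R -> R) :
  continuous f 0 -> filterlim f (at_right 0) (locally (f 0)).
Proof.
  intros Hf. exact (filterlim_filter_le_1 f (filter_le_within _) Hf).
Qed.

(** The standing assumptions, freed from the formula for [g]. The gain condition is represented by
    [0 < h]; its full strength enters later through [k] and [q]. *)
Record rotor (g : R -> R) (J w1 gl gu wrd alpha h : R) : Prop := {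
  rotor_J : 0 < J;
  rotor_w1 : 0 < w1;
  rotor_zero : g w1 = 0;
  rotor_pos : forall w, 0 < w < w1 -> 0 < g w;
  rotor_gl : gl < 0;
  rotor_gu : 0 < gu;
  rotor_diff : forall w, 0 < w -> is_derive g w (Derive g w);
  rotor_slope : forall w, 0 < w -> gl <= Derive g w <= gu;
  rotor_wrd : 0 < wrd <= w1;
  rotor_alpha : 0 < alpha;
  rotor_h : 0 < h
}.

Arguments rotor_J {g J w1 gl gu wrd alpha h}.
Arguments rotor_w1 {g J w1 gl gu wrd alpha h}.
Arguments rotor_zero {g J w1 gl gu wrd alpha h}.
Arguments rotor_pos {g J w1 gl gu wrd alpha h}.
Arguments rotor_gl {g J w1 gl gu wrd alpha h}.
Arguments rotor_gu {g J w1 gl gu wrd alpha h}.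
Arguments rotor_diff {g J w1 gl gu wrd alpha h}.
Arguments rotor_slope {g J w1 gl gu wrd alpha h}.
Arguments rotor_wrd {g J w1 gl gu wrd alpha h}.
Arguments rotor_alpha {g J w1 gl gu wrd alpha h}.
Arguments rotor_h {g J w1 gl gu wrd alpha h}.

Lemma rotor_increment {g : R -> R} {J w1 gl gu wrd alpha h : R} (a b : R) :
  rotor g J w1 gl gu wrd alpha h -> 0 < a -> a <= b ->
  gl * (b - a) <= g b - g a <= gu * (b - a).
Proof.
  intros H Ha Hab.
  destruct (MVT_gen g a b (Derive g)) as [c [Hc Heq]].
  - rewrite Rmin_left by lra. intros x Hx. apply (rotor_diff H). lra.
  - rewrite Rmin_left by lra. intros x Hx. apply continuity_pt_filterlim.
    apply @ex_derive_continuous. exists (Derive g x).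
    apply (rotor_diff H). lra.
  - rewrite Rmin_left in Hc by lra.
    pose proof (rotor_slope H c ltac:(lra)).
    rewrite Heq. split; apply Rmult_le_compat_r; lra.
Qed.

Lemma rotor_lipschitz {g : R -> R} {J w1 gl gu wrd alpha h : R} (a b : R) :
  rotor g J w1 gl gu wrd alpha h -> 0 < a -> 0 < b ->
  Rabs (g a - g b) <= (gu - gl) * Rabs (a - b).
Proof.
  intros H.
  assert (B : forall a b, 0 < a -> a <= b -> Rabs (g a - g b) <= (gu - gl) * Rabs (a - b)).
  { clear a b. intros a b Ha Hab.
    pose proof (rotor_increment a b H Ha Hab).
    pose proof (rotor_gl H). pose proof (rotor_gu H).
    rewrite (Rabs_minus_sym a b), (Rabs_pos_eq (b - a)) by lra.
    assert (0 <= - gl * (b - a)) by (apply Rmult_le_pos; lra).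
    assert (0 <= gu * (b - a)) by (apply Rmult_le_pos; lra).
    apply Rabs_le. lra. }
  intros Ha Hb. destruct (Rle_lt_dec a b) as [Hab|Hab]; [now apply B|].
  rewrite (Rabs_minus_sym (g a)), (Rabs_minus_sym a). apply B; lra.
Qed.

Lemma rotor_nonneg {g : R -> R} {J w1 gl gu wrd alpha h : R} (w : R) :
  rotor g J w1 gl gu wrd alpha h -> 0 < w <= w1 -> 0 <= g w.
Proof.
  intros H [Hw [Hlt| ->]].
  - left. apply (rotor_pos H). lra.
  - rewrite (rotor_zero H). lra.
Qed.

Lemma rotor_bounded {g : R -> R} {J w1 gl gu wrd alpha h : R} (w : R) :
  rotor g J w1 gl gu wrd alpha h -> 0 < w <= w1 -> g w <= - gl * w1.
Proof.
  intros H Hw.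
  pose proof (rotor_increment w w1 H ltac:(lra) ltac:(lra)) as B.
  rewrite (rotor_zero H) in B.
  pose proof (rotor_gl H).
  assert (0 <= - gl * w) by (apply Rmult_le_pos; lra). lra.
Qed.

(** The second equation gives [gh = g w], so the first asks [g w] to equal
    [max (g w + alpha ln (w / wrd)) 0]. For [w < wrd] the positive number [g w] exceeds both
    arguments; for [w > wrd] the first argument exceeds [g w]. *)
Lemma equilibrium_unique (g : R -> R) (J w1 gl gu wrd alpha h w gh : R) :
  rotor g J w1 gl gu wrd alpha h -> 0 < w <= w1 ->
  (rhs_w J alpha wrd g w gh = 0 /\ rhs_g J h g w gh = 0 <-> w = wrd /\ gh = g wrd).
Proof.
  intros H Hw.
  pose proof (rotor_J H) as HJ. pose proof (rotor_h H) as Hh.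
  pose proof (rotor_wrd H) as Hwrd.
  pose proof (rotor_alpha H) as Hal.
  unfold rhs_w, rhs_g. split.
  - intros [E1 E2].
    assert (Hg : gh = g w).
    { apply Rmult_integral in E2. destruct E2 as [E2|E2]; [|lra].
      assert (0 < h / J) by (now apply Rdiv_lt_0_compat). lra. }
    assert (E : g w = Rmax (gh + alpha * ln (w / wrd)) 0).
    { apply Rmult_integral in E1. destruct E1 as [E1|E1]; [lra|].
      pose proof (Rinv_0_lt_compat J HJ). lra. }
    enough (w = wrd) by (subst; tauto).
    subst gh. destruct (Rle_lt_dec w wrd) as [Hle|Hlt].
    + destruct Hle as [Hlt|Heq]; [exfalso|exact Heq].
      pose proof (rotor_pos H w ltac:(lra)) as Hp.
      assert (Hln : ln (w / wrd) < 0).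
      { rewrite <- ln_1. apply ln_increasing; [apply Rdiv_lt_0_compat; lra|].
        apply Rmult_lt_reg_r with wrd; [lra|]. unfold Rdiv.
        rewrite Rmult_assoc, Rinv_l by lra. lra. }
      assert (alpha * ln (w / wrd) < 0) by nra.
      unfold Rmax in E. destruct Rle_dec in E; lra.
    + exfalso.
      assert (Hln : 0 < ln (w / wrd)).
      { rewrite <- ln_1. apply ln_increasing; [lra|].
        apply Rmult_lt_reg_r with wrd; [lra|]. unfold Rdiv.
        rewrite Rmult_assoc, Rinv_l by lra. lra. }
      assert (0 < alpha * ln (w / wrd)) by nra.
      pose proof (Rmax_l (g w + alpha * ln (w / wrd)) 0). lra.
  - intros [-> ->]. pose proof (rotor_nonneg wrd H Hw) as Hn.
    unfold Rdiv. rewrite Rinv_r, ln_1, Rmult_0_r, Rplus_0_r, Rmax_left by lra.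
    split; ring.
Qed.

(* [g] may become positive again beyond [w1], but it grows at most linearly there,
   so [(w - w1) exp (- gu t / J)] cannot increase while it is positive. *)
Lemma solution_upper {g : R -> R} {J w1 gl gu wrd alpha h : R} (w gh : R -> R) :
  rotor g J w1 gl gu wrd alpha h ->
  is_solution (rhs_w J alpha wrd g) (rhs_g J h g) w gh -> w 0 <= w1 ->
  forall t, 0 <= t -> w t <= w1.
Proof.
  intros H [Hpos [Hw0 [_ Hd]]] H0 t Ht.
  pose proof (rotor_J H) as HJ.
  pose proof (rotor_gu H) as Hgu.
  pose proof (rotor_w1 H) as Hw1.
  assert (B : (w t - w1) * exp (- (gu / J) * t) <= 0).
  { apply (barrier_above (fun s => (w s - w1) * exp (- (gu / J) * s))
      (fun s => (rhs_w J alpha wrd g (w s) (gh s) - gu / J * (w s - w1)) * exp (- (gu / J) * s)));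
      [| | | |exact Ht].
    - apply (at_right_mult (fun s => w s - w1) (fun s => exp (- (gu / J) * s))).
      + apply (at_right_comp (fun x => x - w1) w Hw0).
        apply @ex_derive_continuous. auto_derive. easy.
      + apply at_right_continuous. apply @ex_derive_continuous. auto_derive. easy.
    - intros s Hs. destruct (Hd s Hs) as [Hds _].
      auto_derive; [now exists (rhs_w J alpha wrd g (w s) (gh s))|].
      rewrite (is_derive_unique (fun x : R => w x) s _ Hds). ring.
    - rewrite Rmult_0_r, exp_0. lra.
    - intros s Hs Hp. pose proof (exp_pos (- (gu / J) * s)) as He.
      assert (Hws : w1 < w s).
      { apply Rnot_le_lt. intros Hle.
        assert (0 <= (w1 - w s) * exp (- (gu / J) * s)) by (apply Rmult_le_pos; lra). lra. }
      enough (rhs_w J alpha wrd g (w s) (gh s) - gu / J * (w s - w1) <= 0) by nra.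
      pose proof (rotor_increment w1 (w s) H Hw1 ltac:(lra)) as Hi.
      rewrite (rotor_zero H) in Hi.
      pose proof (Rmax_r (gh s + alpha * ln (w s / wrd)) 0).
      unfold rhs_w.
      replace ((g (w s) - Rmax (gh s + alpha * ln (w s / wrd)) 0) / J - gu / J * (w s - w1))
        with (- ((gu * (w s - w1) - g (w s) + Rmax (gh s + alpha * ln (w s / wrd)) 0) / J))
        by (field; lra).
      enough (0 <= (gu * (w s - w1) - g (w s) + Rmax (gh s + alpha * ln (w s / wrd)) 0) / J) by lra.
      apply Rdiv_le_0_compat; lra. }
  pose proof (exp_pos (- (gu / J) * t)) as He.
  apply Rnot_lt_le. intros Hlt.
  assert (0 < (w t - w1) * exp (- (gu / J) * t)) by (apply Rmult_lt_0_compat; lra). lra.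
Qed.

(* [c] is the identity for the system itself and a truncation in the existence proof. *)
Lemma truncated_solution_lower (g : R -> R) (J w1 gl gu wrd alpha h K m : R) (c w gh : R -> R) :
  rotor g J w1 gl gu wrd alpha h ->
  filterlim w (at_right 0) (locally (w 0)) ->
  filterlim gh (at_right 0) (locally (gh 0)) ->
  (forall t, 0 < t -> is_derive w t (rhs_w J alpha wrd g (c (w t)) (gh t)) /\
     is_derive gh t (rhs_g J h g (c (w t)) (gh t))) ->
  (forall t, 0 <= t -> 0 < c (w t) <= w1) ->
  (forall x, x < m -> c x <= m) ->
  0 < m -> m <= w 0 -> gh 0 <= K -> - gl * w1 <= K -> K + alpha * ln (m / wrd) <= 0 ->
  forall t, 0 <= t -> m <= w t.
Proof.
  intros H Hw0 Hg0 Hd Hc Hcm Hm Hmw HK1 HK2 HKm.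
  pose proof (rotor_J H) as HJ. pose proof (rotor_h H) as Hh.
  pose proof (rotor_wrd H) as Hwrd.
  pose proof (rotor_alpha H) as Hal.
  (* The estimate [gh] relaxes towards values of [g], all at most [- gl * w1 <= K], so it cannot
     cross [K] upwards. *)
  assert (Hgh : forall t, 0 <= t -> gh t <= K).
  { apply (barrier_above gh (fun t => rhs_g J h g (c (w t)) (gh t))); [exact Hg0| |exact HK1|].
    - intros t Ht. apply Hd, Ht.
    - intros t Ht HKt. unfold rhs_g.
      pose proof (rotor_bounded (c (w t)) H (Hc t ltac:(lra))).
      assert (0 < h / J) by (now apply Rdiv_lt_0_compat). nra. }
  apply (barrier_below w (fun t => rhs_w J alpha wrd g (c (w t)) (gh t))); [exact Hw0| |exact Hmw|].
  - intros t Ht. apply Hd, Ht.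
  (* Below [m] the argument of the maximum is at most [K + alpha ln (m / wrd) <= 0]: the controller
     is off and [w' = g / J >= 0]. *)
  - intros t Ht Hlt. unfold rhs_w.
    specialize (Hgh t ltac:(lra)). specialize (Hc t ltac:(lra)). specialize (Hcm _ Hlt).
    assert (ln (c (w t) / wrd) <= ln (m / wrd)).
    { apply ln_le; [apply Rdiv_lt_0_compat; lra|].
      apply Rmult_le_compat_r; [left; apply Rinv_0_lt_compat; lra|lra]. }
    assert (alpha * ln (c (w t) / wrd) <= alpha * ln (m / wrd)) by (apply Rmult_le_compat_l; lra).
    rewrite Rmax_right by lra.
    pose proof (rotor_nonneg (c (w t)) H Hc).
    apply Rdiv_le_0_compat; lra.
Qed.

Lemma lower_barrier_exists {g : R -> R} {J w1 gl gu wrd alpha h : R} (w0 K : R) :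
  rotor g J w1 gl gu wrd alpha h -> 0 < w0 ->
  exists m, 0 < m /\ m <= w0 /\ K + alpha * ln (m / wrd) <= 0.
Proof.
  intros H Hw0.
  pose proof (rotor_wrd H) as Hwrd.
  pose proof (rotor_alpha H) as Hal.
  pose proof (exp_pos (- K / alpha)) as He.
  assert (Hp : 0 < wrd * exp (- K / alpha)) by (apply Rmult_lt_0_compat; lra).
  (* The second argument solves [K + alpha ln (m / wrd) = 0]. *)
  exists (Rmin w0 (wrd * exp (- K / alpha))).
  split; [now apply Rmin_pos|]. split; [apply Rmin_l|].
  assert (ln (Rmin w0 (wrd * exp (- K / alpha)) / wrd) <= - K / alpha).
  { rewrite <- (ln_exp (- K / alpha)) at 2. apply ln_le.
    - apply Rdiv_lt_0_compat; [now apply Rmin_pos|lra].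
    - replace (exp (- K / alpha)) with (wrd * exp (- K / alpha) / wrd) at 2 by (field; lra).
      apply Rmult_le_compat_r; [left; apply Rinv_0_lt_compat; lra|apply Rmin_r]. }
  apply Rle_trans with (K + alpha * (- K / alpha)).
  - apply Rplus_le_compat_l, Rmult_le_compat_l; lra.
  - right. field. lra.
Qed.

Lemma solution_lower (g : R -> R) (J w1 gl gu wrd alpha h : R) (w gh : R -> R) :
  rotor g J w1 gl gu wrd alpha h ->
  is_solution (rhs_w J alpha wrd g) (rhs_g J h g) w gh -> w 0 <= w1 ->
  exists m, 0 < m /\ forall t, 0 <= t -> m <= w t.
Proof.
  intros H Hsol H0.
  pose proof (solution_upper w gh H Hsol H0) as Hup.
  destruct Hsol as [Hpos [Hw0 [Hg0 Hd]]].
  destruct (lower_barrier_exists (w 0) (Rmax (gh 0) (- gl * w1)) H) as [m [Hm [Hmw HK]]].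
  { apply Hpos; lra. }
  exists m. split; [exact Hm|].
  apply (truncated_solution_lower g J w1 gl gu wrd alpha h (Rmax (gh 0) (- gl * w1)) m
           (fun x => x) w gh); auto.
  - intros x Hx. lra.
  - apply Rmax_l.
  - apply Rmax_r.
Qed.

(** * Truncation of the field and global existence *)

Definition clamp (a b x : R) : R := Rmax a (Rmin x b).

Lemma clamp_bounds (a b x : R) : a <= b -> a <= clamp a b x <= b.
Proof.
  intros Hab. split; [apply Rmax_l|]. apply Rmax_lub; [exact Hab|apply Rmin_r].
Qed.

Lemma clamp_id (a b x : R) : a <= x <= b -> clamp a b x = x.
Proof. intros Hx. unfold clamp. rewrite Rmin_left, Rmax_right by lra. easy. Qed.

Lemma clamp_lipschitz (a b x y : R) : Rabs (clamp a b x - clamp a b y) <= Rabs (x - y).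
Proof.
  unfold clamp, Rmax, Rmin. repeat destruct Rle_dec; unfold Rabs; repeat destruct Rcase_abs; lra.
Qed.

Lemma Rmax0_lipschitz (x y : R) : Rabs (Rmax x 0 - Rmax y 0) <= Rabs (x - y).
Proof.
  unfold Rmax. repeat destruct Rle_dec; unfold Rabs; repeat destruct Rcase_abs; lra.
Qed.

Lemma ln_div_lipschitz (m v a b : R) :
  0 < m -> 0 < v -> m <= a -> m <= b -> Rabs (ln (a / v) - ln (b / v)) <= / m * Rabs (a - b).
Proof.
  intros Hm Hv.
  assert (B : forall a b, m <= a -> a <= b -> Rabs (ln (a / v) - ln (b / v)) <= / m * Rabs (a - b)).
  { clear a b. intros a b Ha Hab.
    rewrite (Rabs_minus_sym (ln _)), (Rabs_minus_sym a).
    replace (ln (b / v) - ln (a / v)) with (ln (b / a)) by (rewrite !ln_div by lra; ring).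
    rewrite (Rabs_pos_eq (b - a)) by lra.
    pose proof (ln_div_upper b a ltac:(lra) ltac:(lra)) as Hu.
    pose proof (ln_div_lower b a ltac:(lra) ltac:(lra)) as Hl.
    assert (0 <= (b - a) / b) by (apply Rdiv_le_0_compat; lra).
    rewrite Rabs_pos_eq by lra. eapply Rle_trans; [exact Hu|].
    unfold Rdiv. rewrite Rmult_comm. apply Rmult_le_compat_r; [lra|].
    apply Rinv_le_contravar; lra. }
  intros Ha Hb. destruct (Rle_lt_dec a b) as [Hab|Hab]; [now apply B|].
  rewrite (Rabs_minus_sym (ln _)), (Rabs_minus_sym a). apply B; lra.
Qed.

(** Clamping keeps the argument of the logarithm away from [0], where its slope is unbounded, and
    the argument of [g] in the region where its slope bounds hold. *)
Lemma truncated_field_lipschitz {g : R -> R} {J w1 gl gu wrd alpha h : R} (m : R) :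
  rotor g J w1 gl gu wrd alpha h -> 0 < m <= w1 ->
  exists L, 0 < L /\
    lip2 L (fun w gh => rhs_w J alpha wrd g (clamp m w1 w) gh) /\
    lip2 L (fun w gh => rhs_g J h g (clamp m w1 w) gh).
Proof.
  intros H Hm.
  pose proof (rotor_J H) as HJ. pose proof (rotor_h H) as Hh.
  pose proof (rotor_wrd H) as Hwrd.
  pose proof (rotor_alpha H) as Hal.
  pose proof (rotor_gl H). pose proof (rotor_gu H).
  assert (Hiv : 0 < / J) by (now apply Rinv_0_lt_compat).
  assert (Him : 0 < / m) by (apply Rinv_0_lt_compat; lra).
  assert (Ham : 0 < alpha * / m) by (now apply Rmult_lt_0_compat).
  set (S := (gu - gl) + alpha * / m + 1).
  (* A crude constant: the factor [1 + h] dominates both [1] and [h], so that it serves both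
     components. *)
  exists ((1 + h) * S / J).
  assert (Hg : forall x x', Rabs (g (clamp m w1 x) - g (clamp m w1 x')) <= (gu - gl) * Rabs (x - x')).
  { intros x x'. pose proof (clamp_bounds m w1 x ltac:(lra)). pose proof (clamp_bounds m w1 x' ltac:(lra)).
    eapply Rle_trans; [apply (rotor_lipschitz _ _ H); lra|].
    apply Rmult_le_compat_l; [lra|]. apply clamp_lipschitz. }
  assert (Hl : forall x x', Rabs (ln (clamp m w1 x / wrd) - ln (clamp m w1 x' / wrd)) <= / m * Rabs (x - x')).
  { intros x x'. pose proof (clamp_bounds m w1 x ltac:(lra)). pose proof (clamp_bounds m w1 x' ltac:(lra)).
    eapply Rle_trans; [apply (ln_div_lipschitz m); lra|].
    apply Rmult_le_compat_l; [lra|]. apply clamp_lipschitz. }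
  split; [|split].
  - apply Rdiv_lt_0_compat; [|exact HJ]. apply Rmult_lt_0_compat; unfold S; lra.
  - intros x y x' y'. unfold rhs_w. specialize (Hg x x'). specialize (Hl x x').
    set (a := g (clamp m w1 x)) in *. set (a' := g (clamp m w1 x')) in *.
    set (l := ln (clamp m w1 x / wrd)) in *. set (l' := ln (clamp m w1 x' / wrd)) in *.
    replace ((a - Rmax (y + alpha * l) 0) / J - (a' - Rmax (y' + alpha * l') 0) / J)
      with (/ J * ((a - a') - (Rmax (y + alpha * l) 0 - Rmax (y' + alpha * l') 0))) by (field; lra).
    rewrite Rabs_mult, (Rabs_pos_eq (/ J)) by lra.
    replace ((1 + h) * S / J * (Rabs (x - x') + Rabs (y - y')))
      with (/ J * ((1 + h) * S * (Rabs (x - x') + Rabs (y - y')))) by (field; lra).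
    apply Rmult_le_compat_l; [lra|].
    eapply Rle_trans; [apply Rabs_triang|]. rewrite Rabs_Ropp.
    pose proof (Rmax0_lipschitz (y + alpha * l) (y' + alpha * l')) as Hmx.
    assert (Hyl : Rabs (y + alpha * l - (y' + alpha * l')) <= Rabs (y - y') + alpha * / m * Rabs (x - x')).
    { replace (y + alpha * l - (y' + alpha * l')) with ((y - y') + alpha * (l - l')) by ring.
      eapply Rle_trans; [apply Rabs_triang|]. apply Rplus_le_compat_l.
      rewrite Rabs_mult, (Rabs_pos_eq alpha), Rmult_assoc by lra.
      apply Rmult_le_compat_l; lra. }
    pose proof (Rabs_pos (x - x')). pose proof (Rabs_pos (y - y')).
    assert (HS : (gu - gl) * Rabs (x - x') + (Rabs (y - y') + alpha * / m * Rabs (x - x'))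
      <= S * (Rabs (x - x') + Rabs (y - y'))) by (unfold S; nra).
    assert (0 <= h * (S * (Rabs (x - x') + Rabs (y - y')))).
    { apply Rmult_le_pos; [lra|]. apply Rmult_le_pos; unfold S; lra. }
    lra.
  - intros x y x' y'. unfold rhs_g. specialize (Hg x x').
    set (a := g (clamp m w1 x)) in *. set (a' := g (clamp m w1 x')) in *.
    replace (h / J * (a - y) - h / J * (a' - y')) with (/ J * (h * ((a - a') - (y - y')))) by (field; lra).
    rewrite Rabs_mult, (Rabs_pos_eq (/ J)), Rabs_mult, (Rabs_pos_eq h) by lra.
    replace ((1 + h) * S / J * (Rabs (x - x') + Rabs (y - y')))
      with (/ J * ((1 + h) * (S * (Rabs (x - x') + Rabs (y - y'))))) by (field; lra).
    apply Rmult_le_compat_l; [lra|].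
    pose proof (Rabs_pos (x - x')). pose proof (Rabs_pos (y - y')).
    apply Rmult_le_compat; [lra|apply Rabs_pos|lra|].
    eapply Rle_trans; [apply Rabs_triang|]. rewrite Rabs_Ropp. unfold S. nra.
Qed.

(** A global solution of the truncated system stays in [[m, w1]] by the barriers. There the
    truncation is the identity, so it solves the original system. *)
Lemma solution_exists (g : R -> R) (J w1 gl gu wrd alpha h w0 gh0 : R) :
  rotor g J w1 gl gu wrd alpha h -> 0 < w0 <= w1 ->
  exists w gh, is_solution (rhs_w J alpha wrd g) (rhs_g J h g) w gh /\ w 0 = w0 /\ gh 0 = gh0.
Proof.
  intros H Hw0. pose proof (rotor_J H) as HJ.
  destruct (lower_barrier_exists w0 (Rmax gh0 (- gl * w1)) H ltac:(lra)) as [m [Hm [Hmw HK]]].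
  destruct (truncated_field_lipschitz m H ltac:(lra)) as [L [HL [H1 H2]]].
  destruct (picard_lindelof _ _ L w0 gh0 HL H1 H2) as [w [gh [Ew [Eg [Cw [Cg Hd]]]]]].
  exists w, gh.
  assert (Hlow : forall t, 0 <= t -> m <= w t).
  { apply (truncated_solution_lower g J w1 gl gu wrd alpha h (Rmax gh0 (- gl * w1)) m
      (clamp m w1) w gh); auto.
    - apply at_right_continuous, Cw.
    - apply at_right_continuous, Cg.
    - intros t _. pose proof (clamp_bounds m w1 (w t) ltac:(lra)). lra.
    - intros x Hx. unfold clamp. rewrite Rmin_left, Rmax_left by lra. lra.
    - lra.
    - rewrite Eg. apply Rmax_l.
    - apply Rmax_r. }
  assert (Hup : forall t, 0 <= t -> w t <= w1).
  { apply (barrier_above w (fun t => rhs_w J alpha wrd g (clamp m w1 (w t)) (gh t))).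
    - apply at_right_continuous, Cw.
    - intros t Ht. apply Hd, Ht.
    - lra.
    - intros t Ht Hlt.
      (* Beyond [w1] the truncated field sees [g w1 = 0], so [w' <= 0] there. *)
      assert (E : clamp m w1 (w t) = w1) by (unfold clamp; rewrite Rmin_right, Rmax_right; lra).
      rewrite E. unfold rhs_w. rewrite (rotor_zero H).
      pose proof (Rmax_r (gh t + alpha * ln (w1 / wrd)) 0).
      pose proof (Rdiv_le_0_compat (Rmax (gh t + alpha * ln (w1 / wrd)) 0) J ltac:(lra) HJ). lra. }
  split; [|now split]. split; [|split; [|split]].
  - intros t Ht. specialize (Hlow t Ht). lra.
  - apply at_right_continuous, Cw.
  - apply at_right_continuous, Cg.
  - intros t Ht. specialize (Hd t Ht). rewrite clamp_id in Hd; [exact Hd|].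
    split; [apply Hlow|apply Hup]; lra.
Qed.

(** * Lyapunov function *)

(* The integral of [ln (s / v)] from [v] to [w]. *)
Definition log_well (v w : R) : R := w * ln (w / v) - w + v.

Lemma is_derive_log_well (v w : R) :
  0 < v -> 0 < w -> is_derive (log_well v) w (ln (w / v)).
Proof.
  intros Hv Hw. unfold log_well.
  assert (0 < w / v) by (now apply Rdiv_lt_0_compat).
  auto_derive; [exact H|]. unfold Rdiv. field. split; lra.
Qed.

Lemma log_well_upper (v w : R) :
  0 < v -> 0 < w -> log_well v w <= (w - v) * ln (w / v).
Proof.
  intros Hv Hw. unfold log_well. pose proof (ln_div_upper w v Hw Hv) as H.
  assert (v * ln (w / v) <= v * ((w - v) / v)) by (apply Rmult_le_compat_l; lra).
  replace (v * ((w - v) / v)) with (w - v) in H0 by (field; lra). lra.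
Qed.

(** The second derivative of the well is [1 / s >= 1 / b] on [(0, b]], so it dominates the parabola
    [(s - v)^2 / (2 b)]. The proof shows that the derivative of the difference [f] has the sign of
    [s - v]. *)
Lemma log_well_lower (v w b : R) :
  0 < v <= b -> 0 < w <= b -> (w - v) ^ 2 <= 2 * b * log_well v w.
Proof.
  intros Hv Hw.
  set (f := fun s => log_well v s - (s - v) ^ 2 / (2 * b)).
  assert (Hd : forall s, 0 < s -> is_derive f s (ln (s / v) - (s - v) / b)).
  { intros s Hs. unfold f.
    apply (is_derive_minus (log_well v) (fun s => (s - v) ^ 2 / (2 * b)) s).
    - apply is_derive_log_well; lra.
    - auto_derive; [easy|]. field. lra. }
  destruct (MVT_gen f v w (fun s => ln (s / v) - (s - v) / b)) as [c [Hc Heq]].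
  { intros s Hs. apply Hd. pose proof (Rmin_glb_lt v w 0). lra. }
  { intros s Hs. apply continuity_pt_filterlim.
    apply @ex_derive_continuous. eexists. apply Hd. pose proof (Rmin_glb_lt v w 0). lra. }
  assert (Hc0 : 0 < c) by (pose proof (Rmin_glb_lt v w 0); lra).
  assert (Hfv : f v = 0).
  { unfold f, log_well. unfold Rdiv at 1. rewrite Rinv_r, ln_1 by lra. field. lra. }
  assert (Hfw : 0 <= f w).
  { replace (f w) with (f w - f v) by (rewrite Hfv; ring). rewrite Heq.
    destruct (Rle_lt_dec v w) as [Hvw|Hvw].
    - rewrite Rmin_left, Rmax_right in Hc by lra. apply Rmult_le_pos; [|lra].
      pose proof (ln_div_lower c v Hc0 ltac:(lra)).
      assert ((c - v) / b <= (c - v) / c); [|lra].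
      apply Rmult_le_compat_l; [lra|]. apply Rinv_le_contravar; lra.
    - rewrite Rmin_right, Rmax_left in Hc by lra.
      pose proof (ln_div_upper c v Hc0 ltac:(lra)).
      assert ((v - c) / b <= (v - c) / v).
      { apply Rmult_le_compat_l; [lra|]. apply Rinv_le_contravar; lra. }
      assert ((c - v) / b = - ((v - c) / b)) by (field; lra).
      assert ((c - v) / v = - ((v - c) / v)) by (field; lra).
      assert (0 <= - (ln (c / v) - (c - v) / b) * (v - w)) by (apply Rmult_le_pos; lra). lra. }
  assert (Hb : 0 <= 2 * b * f w) by (apply Rmult_le_pos; lra).
  replace (2 * b * f w) with (2 * b * log_well v w - (w - v) ^ 2) in Hb by (unfold f; field; lra).
  lra.
Qed.

(** The factor [alpha] makes the derivative of the second term in [w] equal to [k y] with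
    [y = alpha ln (w / wrd)]. *)
Definition lyap (g : R -> R) (k alpha wrd w gh : R) : R :=
  (gh - g w) ^ 2 / 2 + k * alpha * log_well wrd w.

Lemma lyap_right_continuous {g : R -> R} {J w1 gl gu wrd alpha h : R} (k : R) (w gh : R -> R) :
  rotor g J w1 gl gu wrd alpha h ->
  is_solution (rhs_w J alpha wrd g) (rhs_g J h g) w gh ->
  filterlim (fun t => lyap g k alpha wrd (w t) (gh t)) (at_right 0)
    (locally (lyap g k alpha wrd (w 0) (gh 0))).
Proof.
  intros H [Hpos [Hw0 [Hg0 _]]].
  assert (Hp : 0 < w 0) by (apply Hpos; lra).
  pose proof (rotor_wrd H) as Hwrd.
  apply (at_right_plus (fun t => (gh t - g (w t)) ^ 2 / 2) (fun t => k * alpha * log_well wrd (w t))).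
  - apply (at_right_comp (fun e => e ^ 2 / 2) (fun t => gh t - g (w t))).
    + apply (at_right_plus gh (fun t => - g (w t)) Hg0).
      apply (at_right_comp (fun x => - g x) w Hw0).
      apply @continuous_opp. apply @ex_derive_continuous. eexists. now apply (rotor_diff H).
    + apply @ex_derive_continuous. auto_derive. easy.
  - apply (at_right_comp (fun x => k * alpha * log_well wrd x) w Hw0).
    apply @continuous_scal_r. apply @ex_derive_continuous. eexists.
    apply is_derive_log_well; lra.
Qed.

(** With [u = J w'], the error obeys [J e' = - h e - g'(w) u]; the derivative is [e e' + k y w']. *)
Lemma is_derive_lyap {g : R -> R} {J w1 gl gu wrd alpha h : R} (k : R) (w gh : R -> R) (t : R) :
  rotor g J w1 gl gu wrd alpha h ->
  is_solution (rhs_w J alpha wrd g) (rhs_g J h g) w gh -> 0 < t ->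
  is_derive (fun s => lyap g k alpha wrd (w s) (gh s)) t
    (dissipation h k (Derive g (w t)) (g (w t)) (gh t - g (w t)) (alpha * ln (w t / wrd)) / J).
Proof.
  intros H [Hpos [_ [_ Hd]]] Ht.
  assert (Hp : 0 < w t) by (apply Hpos; lra).
  pose proof (rotor_wrd H) as Hwrd. pose proof (rotor_J H) as HJ.
  destruct (Hd t Ht) as [Hdw Hdg].
  pose proof (rotor_diff H (w t) Hp) as Hg.
  pose proof (is_derive_log_well wrd (w t) ltac:(lra) Hp) as HP.
  unfold lyap.
  auto_derive.
  - repeat split; try (eexists; eassumption).
  - rewrite (is_derive_unique (fun x : R => gh x) t _ Hdg).
    rewrite (is_derive_unique (fun x : R => w x) t _ Hdw).
    rewrite (is_derive_unique (fun x : R => log_well wrd x) (w t) _ HP).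
    change (Derive (fun x : R => g x) (w t)) with (Derive g (w t)).
    unfold dissipation, rhs_w, rhs_g.
    replace (g (w t) + (gh t - g (w t)) + alpha * ln (w t / wrd))
      with (gh t + alpha * ln (w t / wrd)) by ring.
    field. lra.
Qed.

Lemma lyap_lower {g : R -> R} {J w1 gl gu wrd alpha h : R} (k : R) :
  rotor g J w1 gl gu wrd alpha h -> 0 < k ->
  exists B, 0 < B /\ forall w gh, 0 < w <= w1 ->
    (w - wrd) ^ 2 <= B * lyap g k alpha wrd w gh /\
    (gh - g wrd) ^ 2 <= B * lyap g k alpha wrd w gh.
Proof.
  intros H Hk. pose proof (rotor_wrd H) as Hwrd. pose proof (rotor_alpha H) as Hal.
  pose proof (rotor_w1 H) as Hw1.
  assert (Hka : 0 < k * alpha) by (now apply Rmult_lt_0_compat).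
  set (B0 := 2 * w1 / (k * alpha)).
  assert (HB0 : 0 < B0) by (apply Rdiv_lt_0_compat; lra).
  set (L := gu - gl).
  assert (HLB : 0 <= L ^ 2 * B0) by (apply Rmult_le_pos; [apply pow2_ge_0|lra]).
  (* [B0] controls [w - wrd] through the well. The rest comes from
     [gh - g wrd = (gh - g w) + (g w - g wrd)], with [(gh - g w)^2 <= 2 V] and [g] Lipschitz of
     constant [L]. *)
  exists (B0 + 4 + 2 * (L ^ 2 * B0)). split; [lra|]. intros w gh Hw.
  set (V := lyap g k alpha wrd w gh).
  pose proof (log_well_lower wrd w w1 Hwrd Hw) as HP.
  pose proof (pow2_ge_0 (w - wrd)). pose proof (pow2_ge_0 (gh - g w)).
  assert (HP0 : 0 <= log_well wrd w).
  { apply Rmult_le_reg_l with (2 * w1); lra. }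
  assert (HkP : 0 <= k * alpha * log_well wrd w) by (apply Rmult_le_pos; lra).
  assert (HVe : (gh - g w) ^ 2 <= 2 * V) by (unfold V, lyap; lra).
  assert (HVw : (w - wrd) ^ 2 <= B0 * V).
  { apply Rle_trans with (B0 * (k * alpha * log_well wrd w)).
    - replace (B0 * (k * alpha * log_well wrd w)) with (2 * w1 * log_well wrd w)
        by (unfold B0; field; lra). exact HP.
    - apply Rmult_le_compat_l; [lra|]. unfold V, lyap. lra. }
  assert (HV : 0 <= V) by lra.
  assert (HB0V : 0 <= B0 * V) by lra.
  assert (HLV : 0 <= L ^ 2 * B0 * V) by (apply Rmult_le_pos; lra).
  split; [lra|].
  assert (Hl : (g w - g wrd) ^ 2 <= L ^ 2 * (w - wrd) ^ 2).
  { rewrite <- Rpow_mult_distr, <- (pow2_abs (g w - g wrd)), <- (pow2_abs (L * (w - wrd))).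
    apply pow_incr. split; [apply Rabs_pos|].
    pose proof (rotor_gl H). pose proof (rotor_gu H).
    rewrite Rabs_mult, (Rabs_pos_eq L) by (unfold L; lra).
    apply (rotor_lipschitz _ _ H); lra. }
  assert (L ^ 2 * (w - wrd) ^ 2 <= L ^ 2 * (B0 * V))
    by (apply Rmult_le_compat_l; [apply pow2_ge_0|exact HVw]).
  pose proof (pow2_ge_0 ((gh - g w) - (g w - g wrd))).
  assert ((gh - g wrd) ^ 2 <= 2 * (gh - g w) ^ 2 + 2 * (g w - g wrd) ^ 2) by lra.
  lra.
Qed.

(** Within [wrd / 2] of [wrd] the logarithm is Lipschitz with constant [2 / wrd], so both terms are
    quadratic in the distance [d] to the equilibrium. *)
Lemma lyap_upper {g : R -> R} {J w1 gl gu wrd alpha h : R} (k : R) :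
  rotor g J w1 gl gu wrd alpha h -> 0 < k ->
  exists C, 0 < C /\ forall w gh d, 0 < w -> Rabs (w - wrd) <= wrd / 2 ->
    Rabs (w - wrd) <= d -> Rabs (gh - g wrd) <= d ->
    lyap g k alpha wrd w gh <= C * d ^ 2.
Proof.
  intros H Hk. pose proof (rotor_wrd H) as Hwrd. pose proof (rotor_alpha H) as Hal.
  pose proof (rotor_gl H). pose proof (rotor_gu H).
  assert (Hka : 0 < k * alpha) by (now apply Rmult_lt_0_compat).
  set (L := gu - gl).
  assert (HL : 0 < L) by (unfold L; lra).
  assert (H2 : 0 < 2 / wrd) by (apply Rdiv_lt_0_compat; lra).
  assert (Hk2 : 0 < k * alpha * (2 / wrd)) by (now apply Rmult_lt_0_compat).
  exists ((1 + L) ^ 2 / 2 + k * alpha * (2 / wrd)).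
  split; [pose proof (pow2_ge_0 (1 + L)); lra|].
  intros w gh d Hw Hhalf Hd1 Hd2.
  pose proof (Rabs_pos (w - wrd)) as Ha.
  assert (He : (gh - g w) ^ 2 <= (1 + L) ^ 2 * d ^ 2).
  { rewrite <- Rpow_mult_distr, <- (pow2_abs (gh - g w)).
    apply pow_incr. split; [apply Rabs_pos|].
    replace (gh - g w) with ((gh - g wrd) + (g wrd - g w)) by ring.
    eapply Rle_trans; [apply Rabs_triang|].
    pose proof (rotor_lipschitz wrd w H ltac:(lra) Hw) as Hl. fold L in Hl.
    rewrite (Rabs_minus_sym wrd) in Hl.
    assert (L * Rabs (w - wrd) <= L * d) by (apply Rmult_le_compat_l; lra). lra. }
  assert (HP : log_well wrd w <= 2 / wrd * d ^ 2).
  { eapply Rle_trans; [apply log_well_upper; lra|].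
    eapply Rle_trans; [apply Rle_abs|]. rewrite Rabs_mult.
    assert (Hx : Rabs (ln (w / wrd)) <= 2 / wrd * d).
    { assert (Hw2 : wrd / 2 <= w) by (apply Rabs_le_between in Hhalf; lra).
      pose proof (ln_div_lipschitz (wrd / 2) wrd w wrd ltac:(lra) ltac:(lra) Hw2 ltac:(lra)) as Hll.
      replace (wrd / wrd) with 1 in Hll by (field; lra).
      rewrite ln_1, Rminus_0_r in Hll.
      replace (/ (wrd / 2)) with (2 / wrd) in Hll by (field; lra).
      eapply Rle_trans; [exact Hll|]. apply Rmult_le_compat_l; lra. }
    replace (2 / wrd * d ^ 2) with (d * (2 / wrd * d)) by ring.
    apply Rmult_le_compat; [lra|apply Rabs_pos|lra|exact Hx]. }
  assert (k * alpha * log_well wrd w <= k * alpha * (2 / wrd * d ^ 2))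
    by (apply Rmult_le_compat_l; lra).
  unfold lyap. lra.
Qed.

(** * Stability and attraction *)

Lemma Rabs_lt_of_sqr_lt (x e : R) : 0 < e -> x ^ 2 < e ^ 2 -> Rabs x < e.
Proof.
  intros He H. rewrite <- (pow2_abs x) in H. apply Rnot_le_lt. intros Hle.
  assert (e ^ 2 <= Rabs x ^ 2) by (apply pow_incr; lra). lra.
Qed.

Lemma solution_stable (g : R -> R) (J w1 gl gu wrd alpha h k q eps : R) :
  rotor g J w1 gl gu wrd alpha h -> 0 < k -> 0 < q -> q <= h ->
  (forall gam e y, gl <= gam <= gu ->
    q * (e ^ 2 + y ^ 2) <= (h - gam) * e ^ 2 + (k - gam) * e * y + k * y ^ 2) ->
  0 < eps -> exists delta, 0 < delta /\
    forall w gh, is_solution (rhs_w J alpha wrd g) (rhs_g J h g) w gh -> 0 < w 0 <= w1 ->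
      Rabs (w 0 - wrd) < delta -> Rabs (gh 0 - g wrd) < delta ->
      forall t, 0 <= t -> Rabs (w t - wrd) < eps /\ Rabs (gh t - g wrd) < eps.
Proof.
  intros H Hk Hq Hqh HQ Heps.
  pose proof (rotor_wrd H) as Hwrd. pose proof (rotor_J H) as HJ.
  destruct (lyap_lower k H Hk) as [B [HB HlB]].
  destruct (lyap_upper k H Hk) as [C [HC HuC]].
  assert (HBC : 0 < B * C) by (now apply Rmult_lt_0_compat).
  (* The first bound admits the quadratic upper estimate at time [0]. The second gives
     [B C d^2 < eps^2], since [B C < (1 + B C)^2]. *)
  set (d := Rmin (wrd / 2) (eps / (1 + B * C))).
  assert (He' : 0 < eps / (1 + B * C)) by (apply Rdiv_lt_0_compat; lra).
  assert (Hd : 0 < d) by (apply Rmin_pos; lra).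
  assert (Hd1 : d <= wrd / 2) by apply Rmin_l.
  assert (Hd2 : d <= eps / (1 + B * C)) by apply Rmin_r.
  exists d. split; [exact Hd|]. intros w gh Hsol H0 Hw0 Hg0 t Ht.
  pose proof (solution_upper w gh H Hsol (proj2 H0)) as Hup.
  assert (Hpos : forall s, 0 <= s -> 0 < w s <= w1).
  { intros s Hs. split; [now apply (proj1 Hsol)|now apply Hup]. }
  assert (HV : lyap g k alpha wrd (w t) (gh t) <= C * d ^ 2).
  { apply Rle_trans with (lyap g k alpha wrd (w 0) (gh 0)).
    - apply (lyapunov_decreasing _ _ (lyap_right_continuous k w gh H Hsol)
        (fun s Hs => is_derive_lyap k w gh s H Hsol Hs)); [|lra].
      intros s Hs. assert (Hps := Hpos s ltac:(lra)).
      pose proof (dissipation_le_error h k (Derive g (w s)) q (g (w s)) (gh s - g (w s))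
        (alpha * ln (w s / wrd)) Hq Hqh (rotor_nonneg _ H Hps)
        (HQ _ _ _ (rotor_slope H _ (proj1 Hps)))) as Hdis.
      pose proof (pow2_ge_0 (gh s - g (w s))).
      assert (0 <= q * (gh s - g (w s)) ^ 2) by (apply Rmult_le_pos; lra).
      pose proof (Rinv_0_lt_compat J HJ). unfold Rdiv at 1.
      set (D := dissipation _ _ _ _ _ _) in *.
      assert (0 <= - D * / J) by (apply Rmult_le_pos; lra). lra.
    - apply HuC; lra. }
  assert (Hlt : B * lyap g k alpha wrd (w t) (gh t) < eps ^ 2).
  { apply Rle_lt_trans with (B * (C * d ^ 2)); [apply Rmult_le_compat_l; lra|].
    assert (Hde : d * (1 + B * C) <= eps).
    { replace eps with (eps / (1 + B * C) * (1 + B * C)) by (field; lra).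
      apply Rmult_le_compat_r; lra. }
    assert (Hsq : (d * (1 + B * C)) ^ 2 <= eps ^ 2).
    { apply pow_incr. split; [apply Rmult_le_pos; lra|exact Hde]. }
    assert (Hdd : 0 < d ^ 2) by (apply pow_lt; exact Hd).
    rewrite Rpow_mult_distr in Hsq.
    assert (d ^ 2 * (B * C) < d ^ 2 * (1 + B * C) ^ 2) by (apply Rmult_lt_compat_l; nra).
    lra. }
  destruct (HlB (w t) (gh t) (Hpos t Ht)) as [A1 A2].
  split; apply Rabs_lt_of_sqr_lt; lra.
Qed.

(** A value of at least [eta] keeps [e] or [y] away from [0], and [w >= m] bounds [y] from below, so
    the uniform dissipation estimate applies. *)
Lemma lyap_dissipated {g : R -> R} {J w1 gl gu wrd alpha h : R} (k q m eta : R) :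
  rotor g J w1 gl gu wrd alpha h -> 0 < k -> 0 < q -> q <= h ->
  (forall gam e y, gl <= gam <= gu ->
    q * (e ^ 2 + y ^ 2) <= (h - gam) * e ^ 2 + (k - gam) * e * y + k * y ^ 2) ->
  0 < m -> 0 < eta ->
  exists c, 0 < c /\ forall w gh, m <= w <= w1 -> eta <= lyap g k alpha wrd w gh ->
    dissipation h k (Derive g w) (g w) (gh - g w) (alpha * ln (w / wrd)) <= - c.
Proof.
  intros H Hk Hq Hqh HQ Hm Heta.
  pose proof (rotor_wrd H) as Hwrd. pose proof (rotor_alpha H) as Hal.
  pose proof (rotor_w1 H) as Hw1.
  assert (Hkw : 0 < k * w1) by (now apply Rmult_lt_0_compat).
  (* If [|e|] and [|y|] were both below [eps <= 1], the two terms of [lyap] would be at most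
     [eps / 2] and less than [k w1 eps], in total less than [eta]. *)
  set (eps := Rmin 1 (eta / (1 / 2 + k * w1))).
  assert (Heps : 0 < eps).
  { apply Rmin_pos; [lra|]. apply Rdiv_lt_0_compat; lra. }
  assert (Heps1 : eps <= 1) by apply Rmin_l.
  assert (Heps2 : eps * (1 / 2 + k * w1) <= eta).
  { replace eta with (eta / (1 / 2 + k * w1) * (1 / 2 + k * w1)) by (field; lra).
    apply Rmult_le_compat_r; [lra|apply Rmin_r]. }
  (* The speed at which [y = - eps]. It lies below [wrd <= w1], so [g] has a positive minimum on the
     compact interval from [Rmin m we] to [we]; the [Rmin] covers the case [m > we]. *)
  set (we := wrd * exp (- eps / alpha)).
  assert (Hwe : 0 < we < wrd).
  { unfold we. pose proof (exp_pos (- eps / alpha)).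
    assert (exp (- eps / alpha) < 1).
    { rewrite <- exp_0. apply exp_increasing.
      assert (0 < eps / alpha) by (now apply Rdiv_lt_0_compat). lra. }
    split; [apply Rmult_lt_0_compat; lra|].
    rewrite <- (Rmult_1_r wrd) at 2. apply Rmult_lt_compat_l; lra. }
  assert (Hmin : 0 < Rmin m we) by (apply Rmin_pos; lra).
  destruct (continuity_ab_min g (Rmin m we) we) as [x0 [Hx0 Hx0r]].
  { apply Rmin_r. }
  { intros c Hc. apply continuity_pt_filterlim.
    apply @ex_derive_continuous. eexists. apply (rotor_diff H). lra. }
  assert (Hg0 : 0 < g x0) by (apply (rotor_pos H); lra).
  destruct (dissipation_uniform h k q eps (g x0) (- (alpha * ln (m / wrd))) Hq Hqh Heps Hg0)
    as [c [Hc Hunif]].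
  exists c. split; [exact Hc|]. intros w gh Hw HV.
  apply Hunif.
  - apply (rotor_nonneg _ H). lra.
  - apply HQ, (rotor_slope H). lra.
  - intros Hy. apply Hx0.
    assert (Hln : ln (w / wrd) <= - eps / alpha).
    { apply Rmult_le_reg_l with alpha; [lra|].
      replace (alpha * (- eps / alpha)) with (- eps) by (field; lra). exact Hy. }
    assert (Hwwe : w <= we).
    { unfold we. replace w with (wrd * exp (ln (w / wrd))).
      - apply Rmult_le_compat_l; [lra|now apply exp_le].
      - rewrite exp_ln by (apply Rdiv_lt_0_compat; lra). field. lra. }
    split; [|exact Hwwe]. apply Rle_trans with m; [apply Rmin_l|lra].
  - rewrite Ropp_involutive. apply Rmult_le_compat_l; [lra|].
    apply ln_le; [apply Rdiv_lt_0_compat; lra|].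
    apply Rmult_le_compat_r; [left; apply Rinv_0_lt_compat; lra|lra].
  - destruct (Rle_lt_dec eps (Rabs (gh - g w))) as [He|He]; [now left|].
    destruct (Rle_lt_dec eps (Rabs (alpha * ln (w / wrd)))) as [Hy|Hy]; [now right|].
    exfalso.
    assert (He2 : (gh - g w) ^ 2 <= eps).
    { rewrite <- (pow2_abs (gh - g w)). pose proof (Rabs_pos (gh - g w)).
      apply Rle_trans with (eps ^ 2); [apply pow_incr; lra|]. nra. }
    assert (HP : alpha * log_well wrd w < w1 * eps).
    { apply Rle_lt_trans with (w1 * Rabs (alpha * ln (w / wrd))); [|apply Rmult_lt_compat_l; lra].
      apply Rle_trans with (alpha * ((w - wrd) * ln (w / wrd))).
      - apply Rmult_le_compat_l; [lra|]. apply log_well_upper; lra.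
      - replace (alpha * ((w - wrd) * ln (w / wrd))) with ((w - wrd) * (alpha * ln (w / wrd))) by ring.
        eapply Rle_trans; [apply Rle_abs|]. rewrite Rabs_mult.
        apply Rmult_le_compat_r; [apply Rabs_pos|]. apply Rabs_le. lra. }
    assert (k * (alpha * log_well wrd w) < k * (w1 * eps)) by (apply Rmult_lt_compat_l; lra).
    unfold lyap in HV. lra.
Qed.

(** The lower bound [m] depends on the trajectory, and so does the dissipation rate [c]. This
    suffices for [V] to tend to [0], and [V] dominates both squared distances. *)
Lemma solution_attracted (g : R -> R) (J w1 gl gu wrd alpha h k q : R) (w gh : R -> R) :
  rotor g J w1 gl gu wrd alpha h -> 0 < k -> 0 < q -> q <= h ->
  (forall gam e y, gl <= gam <= gu ->
    q * (e ^ 2 + y ^ 2) <= (h - gam) * e ^ 2 + (k - gam) * e * y + k * y ^ 2) ->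
  is_solution (rhs_w J alpha wrd g) (rhs_g J h g) w gh -> 0 < w 0 <= w1 ->
  filterlim w (Rbar_locally p_infty) (locally wrd) /\
  filterlim gh (Rbar_locally p_infty) (locally (g wrd)).
Proof.
  intros H Hk Hq Hqh HQ Hsol H0. pose proof (rotor_J H) as HJ.
  pose proof (solution_upper w gh H Hsol (proj2 H0)) as Hup.
  destruct (solution_lower g J w1 gl gu wrd alpha h w gh H Hsol (proj2 H0)) as [m [Hm Hlow]].
  destruct (lyap_lower k H Hk) as [B [HB HlB]].
  set (V := fun t => lyap g k alpha wrd (w t) (gh t)).
  assert (Hb : forall t, 0 <= t -> 0 < w t <= w1).
  { intros t Ht. specialize (Hup t Ht). specialize (Hlow t Ht). lra. }
  assert (HV0 : forall t, 0 <= t -> 0 <= V t).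
  { intros t Ht. destruct (HlB (w t) (gh t) (Hb t Ht)) as [A _].
    pose proof (pow2_ge_0 (w t - wrd)). apply Rmult_le_reg_l with B; [exact HB|].
    unfold V. lra. }
  assert (Hdec : forall eta, 0 < eta -> exists c, 0 < c /\ forall t, 0 < t -> eta <= V t ->
    dissipation h k (Derive g (w t)) (g (w t)) (gh t - g (w t)) (alpha * ln (w t / wrd)) / J <= - c).
  { intros eta Heta.
    destruct (lyap_dissipated k q m eta H Hk Hq Hqh HQ Hm Heta) as [c [Hc Hdis]].
    exists (c / J). split; [now apply Rdiv_lt_0_compat|]. intros t Ht HVt.
    assert (Hwt : m <= w t <= w1) by (split; [apply Hlow|apply Hup]; lra).
    specialize (Hdis (w t) (gh t) Hwt HVt).
    replace (- (c / J)) with (- c / J) by (field; lra).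
    apply Rmult_le_compat_r; [left; now apply Rinv_0_lt_compat|exact Hdis]. }
  assert (Hlim : forall eta, 0 < eta -> exists T, 0 <= T /\ forall t, T <= t -> V t < eta).
  { apply (lyapunov_vanishes V _ (lyap_right_continuous k w gh H Hsol)
      (fun t Ht => is_derive_lyap k w gh t H Hsol Ht)); [exact HV0| |exact Hdec].
    intros t Ht. assert (Hps := Hb t ltac:(lra)).
    pose proof (dissipation_le_error h k (Derive g (w t)) q (g (w t)) (gh t - g (w t))
      (alpha * ln (w t / wrd)) Hq Hqh (rotor_nonneg _ H Hps)
      (HQ _ _ _ (rotor_slope H _ (proj1 Hps)))) as Hdis.
    pose proof (pow2_ge_0 (gh t - g (w t))).
    assert (0 <= q * (gh t - g (w t)) ^ 2) by (apply Rmult_le_pos; lra).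
    pose proof (Rinv_0_lt_compat J HJ). unfold Rdiv at 1.
    set (D := dissipation _ _ _ _ _ _) in *.
    assert (0 <= - D * / J) by (apply Rmult_le_pos; lra). lra. }
  assert (Hend : forall (f : R -> R) l, (forall t, 0 <= t -> (f t - l) ^ 2 <= B * V t) ->
    filterlim f (Rbar_locally p_infty) (locally l)).
  { intros f l Hf. apply filterlim_locally. intros [e He].
    destruct (Hlim (e ^ 2 / B)) as [T [HT HVT]].
    { apply Rdiv_lt_0_compat; [now apply pow_lt|exact HB]. }
    exists T. intros t Ht. apply (Rabs_lt_of_sqr_lt (f t - l) e He).
    eapply Rle_lt_trans; [apply Hf; lra|].
    replace (e ^ 2) with (B * (e ^ 2 / B)) by (field; lra).
    apply Rmult_lt_compat_l; [exact HB|]. apply HVT. lra. }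
  split; apply Hend; intros t Ht; apply (HlB (w t) (gh t) (Hb t Ht)).
Qed.

(** * The aerodynamic formula for [g] and the theorem *)

Lemma gfun_is_derive (rho A Rad Cf a' beta Vw w d : R) (Cp : R -> R -> R) :
  0 < w -> is_derive (fun l => Cp l beta) (w * Rad / Vw) d ->
  is_derive (gfun rho A Rad Cf a' Cp beta Vw) w
    (Derive (gfun rho A Rad Cf a' Cp beta Vw) w).
Proof.
  intros Hw Hd. apply Derive_correct. unfold gfun.
  auto_derive. repeat split; [now exists d|lra].
Qed.

Theorem theorem1
  (rho A Rad J Cf a' bmin bmax beta Vw : R) (Cp : R -> R -> R)
  (w1 gl gu wrd alpha h : R)
  (Hrho : 0 < rho) (HA : 0 < A) (HRad : 0 < Rad) (HJ : 0 < J) (HCf : 0 < Cf)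
  (Ha' : a' < 0) (Hbeta : bmin <= beta <= bmax) (HVw : 0 < Vw)
  (* (A1) Cp is C^1 on (0,oo) x [bmin,bmax]: continuous partial derivatives
     (one-sided in beta at the endpoints of [bmin,bmax]) *)
  (HA1 : exists Dl Db : R -> R -> R,
     (forall l b, 0 < l -> bmin <= b <= bmax ->
        is_derive (fun l' => Cp l' b) l (Dl l b) /\
        filterlim (fun b' => (Cp l b' - Cp l b) / (b' - b))
          (within (fun b' => bmin <= b' <= bmax /\ b' <> b) (locally b))
          (locally (Db l b)) /\
        filterlim (fun p : R * R => Dl (fst p) (snd p))
          (within (fun p : R * R => 0 < fst p /\ bmin <= snd p <= bmax)
             (locally (l, b)))
          (locally (Dl l b)) /\
        filterlim (fun p : R * R => Db (fst p) (snd p))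
          (within (fun p : R * R => 0 < fst p /\ bmin <= snd p <= bmax)
             (locally (l, b)))
          (locally (Db l b))))
  (* (A2) *)
  (HA2 : exists c, 0 < c /\
     forall l b, 0 < l -> bmin <= b <= bmax -> Cp l b <= c * l)
  (* (A3) *)
  (HA3 : forall b, bmin <= b <= bmax ->
     exists l1, 0 < l1 /\ forall l, 0 < l < l1 -> 0 < Cp l b)
  (* (A4) *)
  (HA4 : exists cl cu, cl < 0 /\ 0 < cu /\
     forall l b, 0 < l -> bmin <= b <= bmax ->
       cl <= Derive (fun l' => Cp l' b / l') l <= cu)
  (* omega_r^(1) *)
  (Hw1 : 0 < w1)
  (Hgw1 : gfun rho A Rad Cf a' Cp beta Vw w1 = 0)
  (Hgpos : forall w, 0 < w < w1 -> 0 < gfun rho A Rad Cf a' Cp beta Vw w)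
  (* bounds on dg/dw *)
  (Hgl : gl < 0) (Hgu : 0 < gu)
  (Hgam : forall w, 0 < w ->
     gl <= Derive (gfun rho A Rad Cf a' Cp beta Vw) w <= gu)
  (* desired speed and gains *)
  (Hwrd : 0 < wrd <= w1)
  (Halpha : 0 < alpha)
  (Hh : if Rle_dec (- (1/3) * gl) gu then h > gu
        else h > - (gu - gl) ^ 2 / (8 * (gl + gu))) :
  let g := gfun rho A Rad Cf a' Cp beta Vw in
  let F1 := rhs_w J alpha wrd g in
  let F2 := rhs_g J h g in
  (* (i) unique equilibrium in D *)
  (forall w gh, inD w1 w gh ->
     (F1 w gh = 0 /\ F2 w gh = 0 <-> (w = wrd /\ gh = g wrd))) /\
  (* (ii) D is positively invariant (and solutions from D exist globally) *)
  (forall w0 gh0, inD w1 w0 gh0 ->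
     exists w gh, is_solution F1 F2 w gh /\ w 0 = w0 /\ gh 0 = gh0) /\
  (forall w gh, is_solution F1 F2 w gh -> inD w1 (w 0) (gh 0) ->
     forall t, 0 <= t -> inD w1 (w t) (gh t)) /\
  (* (iii) local (Lyapunov) stability, relative to D ... *)
  (forall eps, 0 < eps -> exists delta, 0 < delta /\
     forall w gh, is_solution F1 F2 w gh -> inD w1 (w 0) (gh 0) ->
       Rabs (w 0 - wrd) < delta -> Rabs (gh 0 - g wrd) < delta ->
       forall t, 0 <= t -> Rabs (w t - wrd) < eps /\ Rabs (gh t - g wrd) < eps) /\
  (* ... with domain of attraction D *)
  (forall w gh, is_solution F1 F2 w gh -> inD w1 (w 0) (gh 0) ->
     filterlim w (Rbar_locally p_infty) (locally wrd) /\
     filterlim gh (Rbar_locally p_infty) (locally (g wrd))).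
Proof.
  intros g F1 F2.
  destruct (gain_condition_weight gl gu h Hgl Hgu Hh) as [k [Hk [Hk1 Hk2]]].
  destruct (dissipation_form_pos gl gu h k Hgl Hgu Hk Hk1 Hk2) as [q [Hq [Hqh HQ]]].
  assert (H : rotor g J w1 gl gu wrd alpha h).
  (* Positivity of [h] follows from [0 < q <= h]. Differentiability of [g] comes from the partial
     derivative of [Cp] in its first argument at the fixed pitch [beta]. *)
  { constructor; auto; [|lra].
    intros w Hw. destruct HA1 as [Dl [Db HD]].
    assert (Hl : 0 < w * Rad / Vw).
    { apply Rdiv_lt_0_compat; [now apply Rmult_lt_0_compat|exact HVw]. }
    exact (gfun_is_derive rho A Rad Cf a' beta Vw w _ Cp Hw (proj1 (HD _ beta Hl Hbeta))). }
  split; [|split; [|split; [|split]]].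
  - intros w gh Hw. exact (equilibrium_unique g J w1 gl gu wrd alpha h w gh H Hw).
  - intros w0 gh0 Hw0. exact (solution_exists g J w1 gl gu wrd alpha h w0 gh0 H Hw0).
  - intros w gh Hsol H0 t Ht. split; [now apply (proj1 Hsol)|].
    exact (solution_upper w gh H Hsol (proj2 H0) t Ht).
  - intros eps Heps. exact (solution_stable g J w1 gl gu wrd alpha h k q eps H Hk Hq Hqh HQ Heps).
  - intros w gh Hsol H0.
    exact (solution_attracted g J w1 gl gu wrd alpha h k q w gh H Hk Hq Hqh HQ Hsol H0).
Qed.
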